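(* Let $X$ be a Fano manifold that does not admit a Kähler--Einstein metric, i.e. there is no Kähler metric $g_0$ on $X$ with $\mathrm{Ric}(\omega_{g_0})=\omega_{g_0}$. Then no extremal Kähler metric on $X$ is holomorphically isometric to a Kähler--Ricci soliton on $X$; that is, there do not exist an extremal Kähler metric $g$ on $X$, a Kähler--Ricci soliton $g'$ on $X$, and a biholomorphism $\varphi\colon X\to X$ such that $\varphi^*g'=g$.
   Context: A Fano manifold is a connected compact complex manifold $X$ (of complex dimension $n$, with complex structure $J$) whose first Chern class $c_1(X)$ is represented by a Kähler form. For a Kähler metric $g$ on $X$, the Kähler form is normalized by $\omega_g(V,W)=\frac{1}{2\pi}g(JV,W)$. $\mathrm{Ric}(\omega_g)$ denotes the Ricci form normalized so that it represents $c_1(X)$, locally $\mathrm{Ric}(\omega_g)=-\frac{\sqrt{-1}}{2\pi}\partial\bar\partial\log\det(g_{i\bar j})$, and $s(\omega_g)$ denotes the scalar curvature of $g$. For $u\in C^\infty(X,\mathbf{C})$, $\mathrm{grad}^{\mathbf{C}}_{\omega_g}u$ denotes the $(1,0)$-part of the gradient $\mathrm{grad}_g u$; in local holomorphic coordinates it is $\nabla^i u\,\frac{\partial}{\partial z^i}$, and it satisfies $i_{\mathrm{grad}^{\mathbf{C}}_{\omega_g}u}\,\omega_g=\frac{\sqrt{-1}}{2\pi}\bar\partial u$. A Kähler metric $g$ is extremal if $\mathrm{grad}^{\mathbf{C}}_{\omega_g}s(\omega_g)$ is a holomorphic vector field on $X$. A Kähler metric $g$ is a Kähler--Ricci soliton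 if there exists a holomorphic vector field $V$ on $X$ such that $\mathrm{Ric}(\omega_g)-\omega_g=L_V\omega_g$, where $L_V$ is the Lie derivative (in particular $\omega_g$ represents $c_1(X)$). Equivalently, $\omega_g$ represents $c_1(X)$ and $\mathrm{grad}^{\mathbf{C}}_{\omega_g}F_g$ is a holomorphic vector field, where the Ricci potential $F_g\in C^\infty(X,\mathbf{R})$ is the unique real function with $\mathrm{Ric}(\omega_g)-\omega_g=\frac{\sqrt{-1}}{2\pi}\partial\bar\partial F_g$ and $\int_X(1-e^{F_g})\,\omega_g^n=0$. *)

(* Defs.v *)
From HB Require Import structures.
From mathcomp Require Import all_boot all_order all_algebra.
From mathcomp Require Import all_classical all_reals all_analysis.
From mathcomp Require Import complex.
Set Implicit Arguments.
Unset Strict Implicit.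
Unset Printing Implicit Defensive.
Import Order.TTheory GRing.Theory Num.Theory.
Import numFieldNormedType.Exports.
Local Open Scope classical_set_scope.
Local Open Scope complex_scope.
Local Open Scope ring_scope.

Section Coordinates.
Context (R : realType) (n : nat).

(* C^n as a real normed space: (x, y) stands for x + i y. *)
Definition cspace : normedModType R := ('rV[R]_n * 'rV[R]_n)%type.

Implicit Types (U : set cspace) (x v w : cspace) (k : 'I_n).

Definition zc k v : R[i] := v.1 0 k +i* v.2 0 k.
Definition mulJ v : cspace := (- v.2, v.1).
Definition ex k : cspace := (delta_mx 0 k, 0).
Definition ey k : cspace := (0, delta_mx 0 k).

Definition cD v (f : cspace -> R[i]) x : R[i] :=
  'D_v (fun y => complex.Re (f y)) x +i* 'D_v (fun y => complex.Im (f y)) x.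

Definition iC : R[i] := 0 +i* 1.

Definition dz k (f : cspace -> R[i]) x : R[i] :=
  (cD (ex k) f x - iC * cD (ey k) f x) / 2.
Definition dzbar k (f : cspace -> R[i]) x : R[i] :=
  (cD (ex k) f x + iC * cD (ey k) f x) / 2.

Fixpoint Ck_on (m : nat) U (f : cspace -> R) : Prop :=
  (forall x, U x -> {for x, continuous f}) /\
  match m with
  | 0 => True
  | m'.+1 => forall v,
      (forall x, U x -> derivable f x v) /\ Ck_on m' U (fun x => 'D_v f x)
  end.
Definition smooth_on U (f : cspace -> R) := forall m, Ck_on m U f.
Definition csmooth_on U (f : cspace -> R[i]) :=
  smooth_on U (fun x => complex.Re (f x)) /\
  smooth_on U (fun x => complex.Im (f x)).

Definition holomorphic_on U (f : cspace -> R[i]) :=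
  csmooth_on U f /\ forall k x, U x -> dzbar k f x = 0.
Definition holomorphic_map_on U (h : cspace -> cspace) :=
  forall k, holomorphic_on U (fun x => zc k (h x)).

(* b(d/dz_i, d/dzbar_j) for the complex bilinear extension of b *)
Definition herm_mx (b : cspace -> cspace -> R) : 'M[R[i]]_n :=
  \matrix_(i, j)
    (((b (ex i) (ex j) + b (ey i) (ey j))
      +i* (b (ex i) (ey j) - b (ey i) (ex j))) / 4).

End Coordinates.

Record complex_atlas (R : realType) (n : nat) (X : topologicalType) :=
  ComplexAtlas {
  cindex : Type;
  cdom : cindex -> set X;
  chart : cindex -> X -> cspace R n;
  chart_inv : cindex -> cspace R n -> X;
  cdom_open : forall a, open (cdom a);
  cdom_cover : forall p, exists a, cdom a p;
  cimg_open : forall a, open (chart a @` cdom a);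
  chartK : forall a p, cdom a p -> chart_inv a (chart a p) = p;
  chart_continuous : forall a p, cdom a p -> {for p, continuous (chart a)};
  chart_inv_continuous : forall a x, (chart a @` cdom a) x ->
    {for x, continuous (chart_inv a)};
  transition_holomorphic : forall a b,
    holomorphic_map_on
      [set x | (chart a @` cdom a) x /\ cdom b (chart_inv a x)]
      (fun x => chart b (chart_inv a x))
}.

Section Geometry.
Context (R : realType) (n : nat) (X : topologicalType).
Variable A : complex_atlas R n X.
Local Notation E := (cspace R n).
Local Notation I := (cindex A).

Implicit Types (f : X -> X) (a b : I) (x v w : E).

Definition cimg a : set E := chart a @` cdom a.

Definition loc f a b x : E := chart b (f (chart_inv a x)).
Definition loc_dom f a b : set E :=
  [set x | cimg a x /\ cdom b (f (chart_inv a x))].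

Definition holomorphic_map f :=
  continuous f /\ forall a b, holomorphic_map_on (loc_dom f a b) (loc f a b).

Definition biholomorphism f := holomorphic_map f /\
  exists f', [/\ holomorphic_map f', cancel f f' & cancel f' f].

(* Tensors are given by their components in the charts, on constant vectors;
   agreement on overlaps is pullback by the identity. *)
Definition oneform := I -> E -> E -> R.
Definition metric := I -> E -> E -> E -> R.
Definition twoform := I -> E -> E -> E -> R[i].
Definition function := I -> E -> R[i].
Definition vfield := I -> E -> 'rV[R[i]]_n.

Definition pullback1 f (t' t : oneform) := forall a b x v,
  loc_dom f a b x ->
  t a x v = t' b (loc f a b x) ('D_v (loc f a b) x).

(* pullback2 f g' g: the tensor g is f^* g' *)
Definition pullback2 f (g' g : metric) := forall a b x v w,
  loc_dom f a b x ->
  g a x v w = g' b (loc f a b x) ('D_v (loc f a b) x) ('D_w (loc f a b) x).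

Definition smooth_oneform (t : oneform) :=
  [/\ forall a x, cimg a x -> forall (c : R) v w,
        t a x (c *: v + w) = c * t a x v + t a x w,
      forall a v, smooth_on (cimg a) (fun x => t a x v) &
      pullback1 idfun t t].

Definition riemannian (g : metric) :=
  [/\ forall a x, cimg a x -> forall (c : R) v v' w,
        g a x (c *: v + v') w = c * g a x v w + g a x v' w,
      forall a x v w, cimg a x -> g a x v w = g a x w v,
      forall a x v, cimg a x -> v != 0 -> 0 < g a x v v,
      forall a v w, smooth_on (cimg a) (fun x => g a x v w) &
      pullback2 idfun g g].

Definition hermitian (g : metric) := riemannian g /\
  forall a x v w, cimg a x -> g a x (mulJ v) (mulJ w) = g a x v w.

Definition kahler_form (g : metric) : twoform := fun a x v w =>
  (g a x (mulJ v) w / (2 * pi))%:C.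

Definition closed2 (t : twoform) := forall a x u v w, cimg a x ->
  cD u (fun y => t a y v w) x + cD v (fun y => t a y w u) x
  + cD w (fun y => t a y u v) x = 0.

Definition kahler (g : metric) := hermitian g /\ closed2 (kahler_form g).

Definition g_mx (g : metric) a x : 'M[R[i]]_n := herm_mx (g a x).

Definition log_det (g : metric) a x : R := ln (complex.Re (\det (g_mx g a x))).

Definition ricci_mx (g : metric) a x : 'M[R[i]]_n :=
  \matrix_(i, j)
    (- dz i (fun y => dzbar j (fun y' => (log_det g a y')%:C) y) x).

(* (i / 2 pi) sum_(i, j) R_(i jbar) dz_i /\ dzbar_j; for a Hermitian, not
   necessarily Kaehler, metric this is the first Chern form of the Chern
   connection on TX. *)
Definition ricci_form (g : metric) : twoform := fun a x v w =>
  iC R / (2 * pi)%:C * \sum_i \sum_j ricci_mx g a x i j *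
    (zc i v * (zc j w)^* - zc i w * (zc j v)^*).

(* The factor 2 gives the Riemannian scalar curvature of g. *)
Definition scalar_curvature (g : metric) : function := fun a x =>
  2 * \tr (invmx (g_mx g a x) *m ricci_mx g a x).

(* Row k holds g^(k jbar) d u / d zbar_j. *)
Definition gradC (g : metric) (u : function) : vfield := fun a x =>
  (\row_j dzbar j (u a) x) *m invmx (g_mx g a x).

(* V stands for the (1,0)-field sum_k V_k d/dz_k. *)
Definition holomorphic_vfield (V : vfield) :=
  (forall a k, holomorphic_on (cimg a) (fun x => V a x 0 k)) /\
  (forall a b x k, loc_dom idfun a b x ->
     V b (loc idfun a b x) 0 k =
     \sum_j V a x 0 j * dz j (fun y => zc k (loc idfun a b y)) x).

(* The pairings of t with d/dz_k extend t complex linearly. *)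
Definition lie (V : vfield) (t : twoform) : twoform := fun a x v w =>
  \sum_k (V a x 0 k * dz k (fun y => t a y v w) x
    + cD v (fun y => V a y 0 k) x
      * ((t a x (ex R k) w - iC R * t a x (ey R k) w) / 2)
    + cD w (fun y => V a y 0 k) x
      * ((t a x v (ex R k) - iC R * t a x v (ey R k)) / 2)).

(* t is de Rham cohomologous to a first Chern form of X. *)
Definition represents_c1 (t : twoform) :=
  exists (h : metric) (eta : oneform), [/\ hermitian h, smooth_oneform eta &
    forall a x v w, cimg a x ->
      t a x v w - ricci_form h a x v w =
      ('D_v (fun y => eta a y w) x - 'D_w (fun y => eta a y v) x)%:C].

Definition fano_manifold :=
  [/\ hausdorff_space X, compact [set: X], connected [set: X], [set: X] !=set0 &
    exists g : metric, kahler g /\ represents_c1 (kahler_form g)].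

Definition kahler_einstein (g : metric) := kahler g /\
  forall a x v w, cimg a x -> ricci_form g a x v w = kahler_form g a x v w.

Definition extremal (g : metric) := kahler g /\
  holomorphic_vfield (gradC g (scalar_curvature g)).

Definition kahler_ricci_soliton (g : metric) := kahler g /\
  exists V : vfield, holomorphic_vfield V /\
    forall a x v w, cimg a x ->
      ricci_form g a x v w - kahler_form g a x v w = lie V (kahler_form g) a x v w.

End Geometry.

(* Main.v *)
From HB Require Import structures.
Require Import Defs.
From mathcomp Require Import all_boot all_order all_algebra.
From mathcomp Require Import all_classical all_reals all_analysis.
From mathcomp Require Import complex ring.
Set Implicit Arguments.
Unset Strict Implicit.
Unset Printing Implicit Defensive.
Import Order.TTheory GRing.Theory Num.Theory.
Import numFieldNormedType.Exports.
Local Open Scope classical_set_scope.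
Local Open Scope complex_scope.
Local Open Scope ring_scope.

(** The isometry carries the extremality of g over to g'
    ([extremal_transport]), so the point is that a soliton g which is also
    extremal, on a compact manifold, is Kaehler-Einstein
    ([soliton_kahler_einstein]).

    Let s be the trace of the Ricci matrix with respect to g (half of the
    scalar curvature), V the soliton field, alpha_l = V^k g_(k lbar) the
    (0,1)-form dual to V, and N = |V|^2.  The soliton equation reads
    Ric = g + d alpha in coordinates ([soliton_mx]).  Its trace is
    s = n + div V ([scal_soliton]), and since V is holomorphic this gives
    dbar s = - Ric(V, .) ([dzbar_scal]).  As Ric - g is Hermitian, dbar N is
    (Ric - g)(V, .) ([dzbar_sqnorm]).  Adding up, dbar (s + N) = - alpha
    ([soliton_potential]): the real function - (s + N) is a global potential
    of V.

    Extremality says that grad s is holomorphic, so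
    W = grad N = - V - grad s is a holomorphic field as well.  Consider
    p = <V, W>, the derivative of N along V.  It is real ([pairing_real]),
    and because V and W are holomorphic its derivative along V is |W|^2
    ([soliton_derive_pairing]).  Where p attains its maximum or its minimum
    this derivative vanishes, so W = 0 and hence p = 0 there.  Both extreme
    values of p are therefore 0, so p vanishes identically, and then so does
    |W|^2 ([grad_sqnorm_eq0]): N is locally constant.

    Finally, for every real K, dbar (K N - s) = alpha.  So V, and with it N,
    vanishes where K N - s is maximal, and the maximal value is at most that
    of - s.  Letting K be large, N cannot be positive anywhere
    ([soliton_field_eq0]).  Hence V = 0 and the soliton equation becomes
    Ric = omega.

    The maximum principle is applied to functions on the manifold, so s, N and
    p have to be independent of the chart.  For s this rests on the behaviour
    of the Ricci matrix under holomorphic maps ([ric_pullback]): log det g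
    changes by log |det J|^2, which d dbar kills.  The calculus underneath
    starts from directional derivatives: functions with continuous ones are
    differentiable ([C1_differentiable]), which yields the chain rule, and
    second ones commute ([schwarz]). *)

(** * Real calculus on C^n *)

Section DiffCombination.
Context (R : realType) (V W : normedModType R).

Lemma diff_lin_comb (I : Type) (c : I -> V -> R) (b : I -> W) x (r : seq I) :
  (forall i, differentiable (c i) x) ->
  differentiable (fun y => \sum_(i <- r) c i y *: b i) x /\
  forall v, 'd (fun y => \sum_(i <- r) c i y *: b i) x v =
            \sum_(i <- r) 'd (c i) x v *: b i.
Proof.
move=> dc; elim: r => [|i r [dr Er]].
  rewrite (_ : (fun y => _) = cst 0); last by apply/funext => y; rewrite big_nil.
  by split=> [|v]; [exact: differentiable_cst | rewrite diff_cst big_nil].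
rewrite (_ : (fun y => _) = (fun y => c i y *: b i) +
    (fun y => \sum_(i <- r) c i y *: b i)); last first.
  by apply/funext => y; rewrite big_cons.
have di := differentiableZl (b i) (dc i).
split=> [|v]; first exact: differentiableD.
rewrite (diffD di dr) big_cons -Er -[LHS]/('d _ x v + 'd _ x v).
by congr (_ + _); rewrite diffZl.
Qed.

Lemma derive_diff_comp (psi : V -> W) (f : W -> R) x v :
  differentiable psi x -> differentiable f (psi x) ->
  differentiable (f \o psi) x /\ 'D_v (f \o psi) x = 'd f (psi x) ('D_v psi x).
Proof.
move=> dpsi df; have dfp : differentiable (f \o psi) x by apply: differentiable_comp.
split=> //; rewrite (deriveE _ dfp) (deriveE _ dpsi).
by rewrite diff_comp.
Qed.

End DiffCombination.

Section SmoothReal.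
Context (R : realType) (n : nat).
Local Notation E := (cspace R n).
Implicit Types (U : set E) (f g : E -> R) (x v w : E) (m : nat).

Lemma Ck_on_continuous m U f x : Ck_on m U f -> U x -> {for x, continuous f}.
Proof. by case: m => [|m] [+ _]; apply. Qed.

Lemma Ck_on_derivable m U f x v : Ck_on m.+1 U f -> U x -> derivable f x v.
Proof. by move=> [_ /(_ v)[+ _]]; apply. Qed.

Lemma Ck_on_derive m U f v : Ck_on m.+1 U f -> Ck_on m U ('D_v f).
Proof. by move=> [_ /(_ v)[]]. Qed.

Lemma Ck_onW m U f : Ck_on m.+1 U f -> Ck_on m U f.
Proof.
elim: m f => [|m IH] f [cf df]; split=> // v.
by split; [exact: (df v).1 | apply: IH; exact: (df v).2].
Qed.

Lemma Ck_on_sub m U U' f : U `<=` U' -> Ck_on m U' f -> Ck_on m U f.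
Proof.
move=> sUU'; elim: m f => [|m IH] f [cf df]; split=> //.
- by move=> x /sUU'/cf.
- by move=> x /sUU'/cf.
move=> v; split; first by move=> x /sUU'; apply: (df v).1.
exact/IH/(df v).2.
Qed.

Lemma near_open U (P : E -> Prop) x : open U -> U x -> (forall y, U y -> P y) ->
  \forall y \near x, P y.
Proof. by move=> oU Ux UP; apply: filterS UP _; apply: open_nbhs_nbhs. Qed.

Lemma Ck_on_eq m U f g : open U -> {in U, f =1 g} -> Ck_on m U f -> Ck_on m U g.
Proof.
move=> oU; elim: m f g => [|m IH] f g fg [cf df];
  have fgx x (Ux : U x) : {near x, f =1 g}
    by apply: near_open Ux _ => // y Uy; rewrite fg// inE.
all: have cg x (Ux : U x) : {for x, continuous g}
  by have := cf x Ux; rewrite /prop_for /continuous_at -fg ?inE// => cfx;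
    apply: cvg_trans cfx; apply: near_eq_cvg; apply: fgx.
  by split.
split=> // v; split=> [x Ux|].
  by apply: near_eq_derivable (fgx _ Ux) _; apply: (df v).1.
apply: IH (df v).2 => x; rewrite inE => Ux.
by apply: near_eq_derive; apply: fgx.
Qed.

Lemma Ck_on_cst m U (c : R) : Ck_on m U (fun=> c).
Proof.
elim: m c => [|m IH] c; split=> //; try by move=> x _; exact: cvg_cst.
move=> v; split=> [x _|]; first exact: derivable_cst.
by rewrite (_ : 'D_v _ = fun=> 0)//; apply/funext => x; rewrite derive_cst.
Qed.

(** The rules for functions written pointwise, the form in which sums and
    products occur below. *)
Lemma derive_add f g x v : derivable f x v -> derivable g x v ->
  'D_v (fun y => f y + g y) x = 'D_v f x + 'D_v g x.
Proof. exact: deriveD. Qed.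

Lemma derive_mul f g x v : derivable f x v -> derivable g x v ->
  'D_v (fun y => f y * g y) x = f x * 'D_v g x + g x * 'D_v f x.
Proof. exact: deriveM. Qed.

Lemma derive_opp f x v : derivable f x v ->
  'D_v (fun y => - f y) x = - 'D_v f x.
Proof. exact: deriveN. Qed.

Lemma Ck_onD m U f g : open U -> Ck_on m U f -> Ck_on m U g ->
  Ck_on m U (fun x => f x + g x).
Proof.
move=> oU; elim: m f g => [|m IH] f g [cf df] [cg dg].
  by split=> // x Ux; apply: continuousD; [exact: cf|exact: cg].
split=> [x Ux|v]; first by apply: continuousD; [exact: cf|exact: cg].
split=> [x Ux|]; first by apply: derivableD; [exact: (df v).1|exact: (dg v).1].
apply: Ck_on_eq (IH _ _ (df v).2 (dg v).2) => // x; rewrite inE => Ux /=.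
by rewrite derive_add//; [exact: (df v).1|exact: (dg v).1].
Qed.

Lemma Ck_onM m U f g : open U -> Ck_on m U f -> Ck_on m U g ->
  Ck_on m U (fun x => f x * g x).
Proof.
move=> oU; elim: m f g => [|m IH] f g cf cg.
  by split=> // x Ux; apply: continuousM; [exact: cf.1|exact: cg.1].
split=> [x Ux|v]; first by apply: continuousM; [exact: cf.1|exact: cg.1].
split=> [x Ux|].
  by apply: derivableM; [exact: (cf.2 v).1|exact: (cg.2 v).1].
apply: (@Ck_on_eq _ _ (fun x => f x * 'D_v g x + g x * 'D_v f x)) => //.
  move=> x; rewrite inE => Ux /=.
  by rewrite derive_mul//; [exact: (cf.2 v).1|exact: (cg.2 v).1].
apply: Ck_onD => //; apply: IH.
- exact: Ck_onW.
- exact: (cg.2 v).2.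
- exact: Ck_onW.
- exact: (cf.2 v).2.
Qed.

Lemma Ck_onV m U f : open U -> (forall x, U x -> f x != 0) -> Ck_on m U f ->
  Ck_on m U (fun x => (f x)^-1).
Proof.
move=> oU fn0; elim: m => [|m IH] cf.
  by split=> // x Ux; apply: continuousV; [exact: fn0|exact: cf.1].
split=> [x Ux|v]; first by apply: continuousV; [exact: fn0|exact: cf.1].
split=> [x Ux|].
  by apply: derivableV; [exact: fn0|exact: (cf.2 v).1].
apply: (@Ck_on_eq _ _ (fun x => - 1 * ((f x)^-1 * (f x)^-1) * 'D_v f x)) => //.
  move=> x; rewrite inE => Ux /=.
  rewrite [RHS]deriveV//; [|exact: fn0|exact: (cf.2 v).1].
  by rewrite -[RHS]/(- (f x) ^- 2 * 'D_v f x) -exprVn; ring.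
have IHf := IH (Ck_onW cf).
by do !apply: Ck_onM => //; [exact: Ck_on_cst|exact: (cf.2 v).2].
Qed.

Lemma derive_comp_real (h : R -> R) f x v : derivable h (f x) 1 ->
  derivable f x v ->
  derivable (h \o f) x v /\ 'D_v (h \o f) x = 'D_1 h (f x) * 'D_v f x.
Proof.
move=> dh df.
pose l t := t *: v + x.
have l0 : l 0 = x by rewrite /l scale0r add0r.
have dfl : derivable (f \o l) 0 1 by move: df => /derivable1P.
have dh' : derivable h ((f \o l) 0) 1 by rewrite /= l0.
have E1 k : 'D_v k x = 'D_1 (k \o l : R -> R) 0.
  rewrite /derive; set a := (X in X @ _); set b := (X in _ = lim (X @ _)).
  suff -> : a = b by [].
  by apply/funext => t; rewrite /a /b /= /l addr0 scale0r add0r [_%:A]mulr1.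
split.
  apply/derivable1P; rewrite -/l.
  move: dfl dh' => /derivable1_diffP dfl /derivable1_diffP dh'.
  apply/derivable1_diffP; exact: (differentiable_comp dfl dh').
rewrite (E1 (h \o f)) (E1 f) -l0 -!derive1E (_ : (h \o f) \o l = h \o (f \o l))//.
by rewrite (derive1_comp dfl dh').
Qed.

Lemma derive_ln f x v : 0 < f x -> derivable f x v ->
  derivable (fun y => ln (f y)) x v /\
  'D_v (fun y => ln (f y)) x = (f x)^-1 * 'D_v f x.
Proof.
move=> fp df; have [dl El] := is_derive1_ln fp.
by have [d ->] := derive_comp_real dl df; split => //; rewrite El.
Qed.

Lemma Ck_on_ln m U f : open U -> (forall x, U x -> 0 < f x) -> Ck_on m U f ->
  Ck_on m U (fun x => ln (f x)).
Proof.
move=> oU fp cf.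
have C x : U x -> {for x, continuous (fun x => ln (f x))}.
  move=> Ux; apply: (@continuous_comp _ _ _ f (@ln R)).
    exact: Ck_on_continuous cf _.
  exact/continuous_ln/fp.
case: m cf => [|m] cf; first by split.
split=> // v; split=> [x Ux|].
  by have [] := derive_ln (fp _ Ux) ((cf.2 v).1 _ Ux).
apply: (@Ck_on_eq _ _ (fun x => (f x)^-1 * 'D_v f x)) => //.
  by move=> x; rewrite inE => Ux /=; have [_ ->] := derive_ln (fp _ Ux) ((cf.2 v).1 _ Ux).
apply: Ck_onM => //; last exact: (cf.2 v).2.
by apply: Ck_onV => //; [move=> x /fp/lt0r_neq0|exact: Ck_onW].
Qed.

Lemma derive_line f y e (s : R) : derivable f (s *: e + y) e ->
  is_derive s 1 (fun s : R => f (s *: e + y)) ('D_e f (s *: e + y)).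
Proof.
pose g (s : R) := f (s *: e + y).
have H : (fun h : R => h^-1 *: ((g \o shift s) (h *: 1) - g s)) =
    (fun h : R => h^-1 *: ((f \o shift (s *: e + y)) (h *: e) - f (s *: e + y))).
  by apply/funext => h; rewrite /g /= [_%:A]mulr1 scalerDl addrA.
move=> df; apply: DeriveDef; first by rewrite /derivable H.
by rewrite /derive H.
Qed.

(** The mean value theorem along a segment in the direction e; the step t may
    have either sign. *)
Lemma mvt_direction U f y e (t : R) : (forall s : R, `|s| <= `|t| -> U (s *: e + y)) ->
  Ck_on 1 U f ->
  exists2 c : R, `|c| <= `|t| & f (t *: e + y) - f y = t * 'D_e f (c *: e + y).
Proof.
move=> Uy cf.
have der (s : R) : `|s| <= `|t| ->
    is_derive s 1 (fun s : R => f (s *: e + y)) ('D_e f (s *: e + y)).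
  by move=> st; apply: derive_line; apply: Ck_on_derivable cf (Uy _ st).
have y0 : f y = f (0 *: e + y) by rewrite scale0r add0r.
have within_ct (a b : R) : (forall s, s \in `[a, b] -> `|s| <= `|t|) ->
    {within `[a, b], continuous (fun s : R => f (s *: e + y))}.
  move=> ab; apply: derivable_within_continuous => s /ab /der [] //.
have [t0|t0] := leP 0 t.
  have tE : `|t| = t by rewrite ger0_norm.
  have sub (s : R) : s \in `[0, t] -> `|s| <= `|t|.
    by rewrite in_itv /= tE => /andP[s0 st]; rewrite ger0_norm.
  have [c cab] := @MVT_segment _ _ (fun s => 'D_e f (s *: e + y)) _ _ t0
     (fun s sab => der s (sub s (subset_itv_oo_cc sab))) (within_ct _ _ sub).
  by rewrite -y0 subr0 => ->; exists c; rewrite 1?mulrC//; apply: sub.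
have sub (s : R) : s \in `[t, 0] -> `|s| <= `|t|.
  by rewrite in_itv /= => /andP[s0 st]; rewrite (ler0_norm st) (ltr0_norm t0) lerN2.
have [c cab] := @MVT_segment _ _ (fun s => 'D_e f (s *: e + y)) _ _ (ltW t0)
     (fun s sab => der s (sub s (subset_itv_oo_cc sab))) (within_ct _ _ sub).
rewrite -y0 sub0r => Ec; exists c; first exact: sub.
by rewrite -opprB Ec; ring.
Qed.

(** The increment along a combination of directions is accumulated one
    direction at a time, with the mean value theorem for each of them. *)
Lemma increment_estimate U f x (I : Type) (e : I -> E) (s : seq I) : open U -> U x ->
  Ck_on 1 U f -> forall eps : R, 0 < eps -> exists2 d : R, 0 < d &
  forall t : I -> R, (forall i, `|t i| <= d) ->
  `|f (x + \sum_(i <- s) t i *: e i) - f x - \sum_(i <- s) t i * 'D_(e i) f x|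
    <= eps * \sum_(i <- s) `|t i|.
Proof.
move=> oU Ux cf eps eps0; elim: s => [|m s [d d0 IH]].
  exists 1 => // t _; rewrite !big_nil addr0 subrr subr0 normr0 mulr0 //.
have cD : {for x, continuous ('D_(e m) f)}.
  exact: Ck_on_continuous (Ck_on_derive _ cf) Ux.
have /nbhs_ballP[r /= r0 rP] : \forall y \near x,
    U y /\ `|'D_(e m) f x - 'D_(e m) f y| < eps.
  near=> y; split; near: y; first exact: open_nbhs_nbhs.
  by move/cvgrPdist_lt : cD; apply.
pose M := 1 + \sum_(i <- m :: s) `|e i|.
have M0 : 0 < M by rewrite ltr_pwDl// sumr_ge0.
(* Steps of this size keep every intermediate point in the ball of radius r. *)
exists (Num.min d (r / (2 * M))).
  by rewrite lt_min d0 divr_gt0// mulr_gt0.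
move=> t tP.
have td i : `|t i| <= d.
  by apply: le_trans (tP _) _; rewrite ge_min lexx.
have tr i : `|t i| <= r / (2 * M).
  by apply: le_trans (tP _) _; rewrite ge_min lexx orbT.
set y := x + \sum_(i <- s) t i *: e i.
have inb (c : R) : `|c| <= `|t m| -> ball x r (c *: e m + y).
  move=> ct; rewrite -ball_normE /ball_ /= /y.
  rewrite (_ : _ - _ = - (\sum_(i <- s) t i *: e i + c *: e m)); last first.
    by rewrite addrCA opprD addNKr addrC.
  rewrite normrN (@le_lt_trans _ _ (r / (2 * M) * \sum_(i <- m :: s) `|e i|))//.
    rewrite big_cons mulrDr mulr_sumr.
    apply: le_trans (ler_normD _ _) _; rewrite addrC; apply: lerD.
      by rewrite normrZ ler_wpM2r// (le_trans ct)// tr.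
    apply: le_trans (ler_norm_sum _ _ _) _; apply: ler_sum => i _.
    by rewrite normrZ ler_wpM2r.
  rewrite (@lt_le_trans _ _ (r / (2 * M) * (2 * M)))//; last first.
    by rewrite divfK// gt_eqF// mulr_gt0.
  rewrite ltr_pM2l ?divr_gt0 ?mulr_gt0//.
  rewrite (@lt_le_trans _ _ M)//; last by rewrite ler_peMl// ?ltW// ltr1n.
  by rewrite /M ltrDr.
rewrite !big_cons (addrCA x) -/y.
have [c ct Ec] := @mvt_direction U f y (e m) (t m) (fun c ct => (rP _ (inb c ct)).1) cf.
set S := \sum_(i <- s) t i * _.
rewrite (_ : _ - _ = f y - f x - S +
    t m * ('D_(e m) f (c *: e m + y) - 'D_(e m) f x)); last first.
  by rewrite mulrBr -Ec; ring.
rewrite [leRHS]mulrDr addrC; apply: le_trans (ler_normD _ _) _; apply: lerD.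
  rewrite normrM mulrC ler_wpM2r// distrC; apply: ltW.
  exact: (rP _ (inb c ct)).2.
exact: IH.
Unshelve. all: by end_near. Qed.

Lemma row_fst_le (w : E) k : `|w.1 0 k| <= `|w|.
Proof.
rewrite prod_normE le_max; apply/orP; left.
by rewrite [leRHS]/Num.Def.normr/= mx_normrE; apply: (le_bigmax _ _ (0, k)).
Qed.

Lemma row_snd_le (w : E) k : `|w.2 0 k| <= `|w|.
Proof.
rewrite prod_normE le_max; apply/orP; right.
by rewrite [leRHS]/Num.Def.normr/= mx_normrE; apply: (le_bigmax _ _ (0, k)).
Qed.

Definition rbasis (i : 'I_n + 'I_n) : E :=
  match i with inl k => ex R k | inr k => ey R k end.
Definition rcoord (w : E) (i : 'I_n + 'I_n) : R :=
  match i with inl k => w.1 0 k | inr k => w.2 0 k end.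

Lemma rcoord_le w i : `|rcoord w i| <= `|w|.
Proof. by case: i => k; [exact: row_fst_le | exact: row_snd_le]. Qed.

Lemma sum_fst (I : Type) (s : seq I) (F : I -> E) :
  (\sum_(i <- s) F i).1 = \sum_(i <- s) (F i).1.
Proof. by elim/big_rec2: _ => //= i _ y _ <-. Qed.

Lemma sum_snd (I : Type) (s : seq I) (F : I -> E) :
  (\sum_(i <- s) F i).2 = \sum_(i <- s) (F i).2.
Proof. by elim/big_rec2: _ => //= i _ y _ <-. Qed.

Lemma cspace_eq (u w : E) : u.1 = w.1 -> u.2 = w.2 -> u = w.
Proof. by case: u w => [? ?] [? ?] /= -> ->. Qed.

Lemma rcoord_rbasis w : w = \sum_i rcoord w i *: rbasis i.
Proof.
have H (v : 'rV[R]_n) : \sum_k v 0 k *: delta_mx 0 k = v.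
  by rewrite [RHS]row_sum_delta.
rewrite big_sumType /=; apply: cspace_eq.
  rewrite /= !sum_fst /= H big1 ?addr0// => k _; by rewrite scaler0.
rewrite /= !sum_snd /= H big1 ?add0r// => k _; by rewrite scaler0.
Qed.

Lemma rcoord_linear i : linear (rcoord ^~ i).
Proof. by case: i => k a u v /=; rewrite !mxE. Qed.

Lemma rcoord_continuous i : continuous (rcoord ^~ i).
Proof.
case: i => k w /=.
  apply: (@continuous_comp _ _ _ fst (fun v : 'rV[R]_n => v 0 k)); first exact: cvg_fst.
  exact: coord_continuous.
apply: (@continuous_comp _ _ _ snd (fun v : 'rV[R]_n => v 0 k)); first exact: cvg_snd.
exact: coord_continuous.
Qed.

Lemma rcoord_sum_continuous (c : 'I_n + 'I_n -> R) (r : seq ('I_n + 'I_n)) :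
  continuous (fun w : E => \sum_(i <- r) rcoord w i * c i : R).
Proof.
elim: r => [|i r IH] w.
  rewrite (_ : (fun w => _) = cst 0); first exact: cvg_cst.
  by apply/funext => u; rewrite big_nil.
rewrite (_ : (fun w => _) = (fun u => rcoord u i * c i +
    \sum_(i <- r) rcoord u i * c i)); last first.
  by apply/funext => u; rewrite big_cons.
apply: (@continuousD _ _ _ (fun u => rcoord u i * c i : R)); last exact: IH.
by apply: continuousM; [exact: rcoord_continuous | exact: cvg_cst].
Qed.

(** The increment estimate along the coordinate directions says that the
    partial derivatives are the coefficients of a differential.  In
    particular the derivative along w, so far an independent limit for each
    w, turns out to be linear in w. *)
Lemma C1_differentiable U f x : open U -> U x -> Ck_on 1 U f -> differentiable f x /\
  forall w, 'd f x w = \sum_i rcoord w i * 'D_(rbasis i) f x.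
Proof.
move=> oU Ux cf.
pose d w := \sum_i rcoord w i * 'D_(rbasis i) f x.
have lin_d : linear d.
  move=> a u v; rewrite /d scaler_sumr -big_split /=; apply: eq_bigr => i _.
  by rewrite rcoord_linear mulrDl -mulrA.
pose dM := GRing.isLinear.Build _ _ _ _ _ lin_d.
pose dL : {linear _ -> _} := HB.pack d dM.
have cd : continuous dL.
  exact: rcoord_sum_continuous.
have ed : f \o shift x = cst (f x) + dL +o_ 0 id.
  apply/eqaddoE; apply/eqaddoP => /= eps eps0.
  pose N : R := 1 + \sum_(i : 'I_n + 'I_n) 1.
  have N0 : 0 < N by rewrite ltr_pwDl// sumr_ge0.
  have [r r0 rP] := increment_estimate rbasis (index_enum _) oU Ux cf (divr_gt0 eps0 N0).
  near=> w.
  have wr : `|w| <= r by near: w; rewrite !near_simpl; apply: nbhs0_le.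
  rewrite -[X in `|X|]/(f (w + x) - (f x + d w)) opprD addrA.
  rewrite {1}(rcoord_rbasis w) (addrC _ x).
  apply: le_trans (rP (rcoord w) _) _.
    by move=> i; apply: le_trans (rcoord_le _ _) wr.
  rewrite -mulrA ler_pM2l// ler_pdivrMl// mulrDl mul1r.
  apply: (@le_trans _ _ (\sum_(i : 'I_n + 'I_n) 1 * `|w|)).
    by apply: ler_sum => i _; rewrite mul1r rcoord_le.
  by rewrite -mulr_suml lerDr.
have dE : 'd f x = dL :> (E -> R) by apply: diff_unique.
split; last by move=> w; rewrite dE.
by apply/diff_locallyP; rewrite dE.
Unshelve. all: by end_near. Qed.

Lemma derive_coord U f x w : open U -> U x -> Ck_on 1 U f ->
  'D_w f x = \sum_i rcoord w i * 'D_(rbasis i) f x.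
Proof. by move=> oU Ux /(C1_differentiable oU Ux)[df <-]; rewrite deriveE. Qed.

Lemma differentiable_map U (psi : E -> E) x : open U -> U x ->
  (forall i, Ck_on 1 U (fun y => rcoord (psi y) i)) ->
  differentiable psi x /\
  forall v, 'D_v psi x = \sum_i 'D_v (fun y => rcoord (psi y) i) x *: rbasis i.
Proof.
move=> oU Ux cpsi.
have dc i : differentiable (fun y => rcoord (psi y) i) x.
  exact: (C1_differentiable oU Ux (cpsi i)).1.
have [] := diff_lin_comb rbasis (index_enum _) dc.
rewrite (_ : (fun y => _) = psi); last by apply/funext => y; rewrite -rcoord_rbasis.
move=> dpsi Epsi; split=> // v; rewrite deriveE// Epsi; apply: eq_bigr => i _.
by rewrite deriveE.
Qed.

Lemma derive_comp U U' (psi : E -> E) f x v : open U -> U x -> open U' ->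
  U' (psi x) -> (forall i, Ck_on 1 U (fun y => rcoord (psi y) i)) ->
  Ck_on 1 U' f ->
  derivable (fun y => f (psi y)) x v /\
  'D_v (fun y => f (psi y)) x =
    \sum_i 'D_v (fun y => rcoord (psi y) i) x * 'D_(rbasis i) f (psi x).
Proof.
move=> oU Ux oU' Ux' cpsi cf.
have [dpsi Epsi] := differentiable_map oU Ux cpsi.
have [df _] := C1_differentiable oU' Ux' cf.
have [dfp Efp] := derive_diff_comp v dpsi df.
split; first exact: diff_derivable dfp.
rewrite [LHS]Efp Epsi linear_sum.
by apply: eq_bigr => i _; rewrite linearZ /= -deriveE.
Qed.

Lemma Ck_on_sum m U (I : Type) (r : seq I) (F : I -> E -> R) : open U ->
  (forall i, Ck_on m U (F i)) -> Ck_on m U (fun y => \sum_(i <- r) F i y).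
Proof.
move=> oU cF; elim: r => [|i r IH].
  rewrite (_ : (fun y => _) = fun=> 0); first exact: Ck_on_cst.
  by apply/funext => y; rewrite big_nil.
rewrite (_ : (fun y => _) = fun y => F i y + \sum_(i <- r) F i y).
  exact: Ck_onD.
by apply/funext => y; rewrite big_cons.
Qed.

(** By induction on m: the chain rule expresses the derivatives of the
    composite by sums of products of the derivatives of psi and composites
    of the derivatives of f. *)
Lemma Ck_on_comp m U U' (psi : E -> E) f : open U -> open U' ->
  (forall x, U x -> U' (psi x)) ->
  (forall i, Ck_on m U (fun y => rcoord (psi y) i)) ->
  Ck_on m U' f -> Ck_on m U (fun y => f (psi y)).
Proof.
move=> oU oU' UU'.
have cpsi0 : (forall i, Ck_on 0 U (fun y => rcoord (psi y) i)) -> forall x, U x ->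
    {for x, continuous psi}.
  move=> c x Ux; rewrite (_ : psi = fun y => ((\row_k rcoord (psi y) (inl k),
      \row_k rcoord (psi y) (inr k)) : E)); last first.
    by apply/funext => y; apply: cspace_eq; apply/rowP => k; rewrite !mxE.
  have H (s : 'I_n -> 'I_n + 'I_n) :
      (\row_k rcoord (psi y) (s k) : 'rV[R]_n) @[y --> x] --> \row_k rcoord (psi x) (s k).
    apply/cvgrPdist_lt => e e0; near=> y.
    rewrite [ltLHS]/Num.Def.normr/= mx_normrE; apply: bigmax_lt => // -[i k] _ /=.
    rewrite !mxE /=; move: k; near: y; apply: filter_forall => k.
    by move: (c (s k)) => [/(_ _ Ux)/cvgrPdist_lt/(_ _ e0)].
  exact: (cvg_pair (H _) (H _)).
have C0 f' m' : (forall i, Ck_on m' U (fun y => rcoord (psi y) i)) -> Ck_on m' U' f' ->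
    forall x, U x -> {for x, continuous (fun y => f' (psi y))}.
  move=> cp cf x Ux; apply: (@continuous_comp _ _ _ psi f').
    by apply: cpsi0 => // i; split=> // z; apply: Ck_on_continuous (cp i).
  exact: Ck_on_continuous cf (UU' _ Ux).
elim: m f => [|m IH] f cp cf; first by split=> //; apply: C0 cp cf.
have c1 k (V : set E) (h : E -> R) : Ck_on k.+1 V h -> Ck_on 1 V h.
  by elim: k => // k IHk /Ck_onW.
have D x v Ux := @derive_comp U U' psi f x v oU Ux oU' (UU' _ Ux)
  (fun i => c1 _ _ _ (cp i)) (c1 _ _ _ cf).
split=> [|v]; first exact: C0 cp cf.
split=> [x Ux|]; first by have [] := D x v Ux.
apply: (@Ck_on_eq _ _ (fun x => \sum_i 'D_v (fun y => rcoord (psi y) i) x *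
   'D_(rbasis i) f (psi x))) => //.
  by move=> x; rewrite inE => Ux; have [_ ->] := D x v Ux.
apply: Ck_on_sum => // i; apply: Ck_onM => //; first exact: Ck_on_derive.
apply: (IH ('D_(rbasis i) f)); last exact: Ck_on_derive.
by move=> j; apply: Ck_onW.
Unshelve. all: by end_near. Qed.

Lemma Ck_on_coord m U i : Ck_on m U (rcoord ^~ i).
Proof.
have dl x v : is_derive x v (rcoord ^~ i) (rcoord v i).
  pose cM := GRing.isLinear.Build _ _ _ _ _ (rcoord_linear i).
  pose cL : {linear _ -> _} := HB.pack (rcoord ^~ i) cM.
  have cc : continuous cL by exact: rcoord_continuous.
  have dd : differentiable cL x by exact: linear_differentiable.
  by apply: DeriveDef; [exact: diff_derivable | rewrite deriveE// (diff_lin _ cc)].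
case: m => [|m]; (split=> //; first by move=> x _; exact: rcoord_continuous).
move=> v; split=> [x _|]; first by have [] := dl x v.
rewrite (_ : 'D_v _ = fun=> rcoord v i); first exact: Ck_on_cst.
by apply/funext => x; have [_ ->] := dl x v.
Qed.

Lemma Ck_on_shift m U f a : open U -> Ck_on m U f ->
  open [set y | U (a + y)] /\ Ck_on m [set y | U (a + y)] (fun y => f (a + y)).
Proof.
move=> oU cf.
have oV : open [set y | U (a + y)].
  apply: (@open_comp _ _ (fun y => a + y) U) => // y _.
  by apply: continuousD; [exact: cvg_cst | exact: cvg_id].
split=> //; apply: (@Ck_on_comp _ _ U (fun y => a + y)) => // i.
rewrite (_ : (fun y => _) = fun y => rcoord a i + rcoord y i).
  by apply: Ck_onD => //; [exact: Ck_on_cst | exact: Ck_on_coord].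
apply/funext => y; have := rcoord_linear i 1 a y.
by rewrite !scale1r.
Qed.

Lemma derive_shift_arg f a x v : 'D_v (fun y => f (a + y)) x = 'D_v f (a + x).
Proof.
rewrite /derive; set F := (X in lim (X @ _)); set G := (X in _ = lim (X @ _)).
suff -> : F = G by [].
by apply/funext => t; rewrite /F /G /= addrCA.
Qed.

(** The mean value theorem for the difference f (h w + y) - f y in the
    direction v, followed by the one for the derivative along v in the
    direction w. *)
Lemma second_difference U f x v w (h : R) : open U -> Ck_on 2 U f ->
  (forall s t : R, `|s| <= `|h| -> `|t| <= `|h| -> U (t *: w + (s *: v + x))) ->
  exists s t : R, [/\ `|s| <= `|h|, `|t| <= `|h| &
    f (h *: w + (h *: v + x)) - f (h *: v + x) - (f (h *: w + x) - f x) =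
    h * (h * 'D_w ('D_v f) (t *: w + (s *: v + x)))].
Proof.
move=> oU cf UP.
have [oV cV] := Ck_on_shift (h *: w) oU (Ck_onW cf).
pose W := [set y | U (h *: w + y)] `&` U.
have oW : open W by apply: openI.
have cg : Ck_on 1 W (fun y => f (h *: w + y) + (-1) * f y).
  apply: Ck_onD => //; first by apply: Ck_on_sub cV => y [].
  by apply: Ck_onM => //; [exact: Ck_on_cst | apply: Ck_on_sub (Ck_onW cf) => y []].
have WP (s : R) : `|s| <= `|h| -> W (s *: v + x).
  move=> sh; split; first by apply: UP.
  by have := UP s 0 sh; rewrite scale0r add0r normr0; apply.
have [s sh Es] := mvt_direction WP cg.
have Us := WP s sh.
have Dg : 'D_v (fun y => f (h *: w + y) + (-1) * f y) (s *: v + x) =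
    'D_v f (h *: w + (s *: v + x)) - 'D_v f (s *: v + x).
  have d1 : derivable (fun y => f (h *: w + y)) (s *: v + x) v.
    by apply: Ck_on_derivable cV _; case: Us.
  have d2 : derivable f (s *: v + x) v.
    by apply: Ck_on_derivable cf _; case: Us.
  have dc : derivable (fun=> -1 : R) (s *: v + x) v by exact: derivable_cst.
  rewrite (derive_add d1 (derivableM dc d2)) (derive_mul dc d2) derive_shift_arg.
  by rewrite derive_cst; ring.
have [t th Et] := @mvt_direction U ('D_v f) (s *: v + x) w h (fun t th => UP s t sh th) (Ck_on_derive v cf).
exists s, t; split=> //.
by rewrite -Et -Dg -Es; ring.
Qed.

(** The second difference is symmetric in the two directions, so both mixed
    derivatives are limits of the same quotients. *)
Lemma schwarz U f x v w : open U -> U x -> Ck_on 2 U f ->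
  'D_v ('D_w f) x = 'D_w ('D_v f) x.
Proof.
move=> oU Ux cf; apply/eqP/negPn/negP => neq.
have [e e0 eE] : exists2 e : R, 0 < e & `|'D_v ('D_w f) x - 'D_w ('D_v f) x| = e + e.
  exists (`|'D_v ('D_w f) x - 'D_w ('D_v f) x| / 2); last exact: splitr.
  by rewrite divr_gt0// normr_gt0 subr_eq0.
have cont a b : {for x, continuous ('D_a ('D_b f))}.
  exact: Ck_on_continuous (Ck_on_derive a (Ck_on_derive b cf)) Ux.
have /nbhs_ballP[r /= r0 rP] : \forall y \near x, [/\ U y,
    `|'D_v ('D_w f) x - 'D_v ('D_w f) y| < e & `|'D_w ('D_v f) x - 'D_w ('D_v f) y| < e].
  have HU : nbhs x U by apply: open_nbhs_nbhs.
  have H1 := (cvgrPdist_lt _ _).1 (cont v w) e e0.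
  have H2 := (cvgrPdist_lt _ _).1 (cont w v) e e0.
  apply: filterS3 HU (H1 _) (H2 _) => y Uy h1 h2; split; [exact: Uy|exact: h1|exact: h2].
pose M := 1 + `|v| + `|w|.
have M0 : 0 < M by rewrite /M -addrA ltr_pwDl// addr_ge0.
pose h := r / (2 * M).
have h0 : 0 < h by rewrite divr_gt0// mulr_gt0.
have inb a b (s t : R) : `|a| + `|b| <= M -> `|s| <= `|h| -> `|t| <= `|h| ->
    ball x r (t *: a + (s *: b + x)).
  rewrite (ger0_norm (ltW h0)) => abM sh th; rewrite -ball_normE /ball_ /=.
  rewrite !addrA opprD addrCA subrr addr0 normrN.
  apply: (@le_lt_trans _ _ (h * M)).
    apply: (@le_trans _ _ (h * (`|a| + `|b|))); last by rewrite ler_pM2l.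
    apply: le_trans (ler_normD _ _) _; rewrite mulrDr !normrZ.
    by apply: lerD; apply: ler_wpM2r.
  rewrite /h invfM mulrA divfK ?gt_eqF//.
  by rewrite ltr_pdivrMr// ltr_pMr// ltr1n.
have bM1 : `|v| + `|w| <= M by rewrite /M -addrA lerDr.
have bM2 : `|w| + `|v| <= M by rewrite addrC.
have [s [t [sh th E1]]] := @second_difference U f x v w h oU cf
  (fun s t sh th => let: And3 a _ _ := rP _ (inb w v s t bM2 sh th) in a).
have [s' [t' [sh' th' E2]]] := @second_difference U f x w v h oU cf
  (fun s t sh th => let: And3 a _ _ := rP _ (inb v w s t bM1 sh th) in a).
have E : 'D_w ('D_v f) (t *: w + (s *: v + x)) = 'D_v ('D_w f) (t' *: v + (s' *: w + x)).
  have hn0 : h != 0 by rewrite gt_eqF.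
  apply: (mulfI hn0); apply: (mulfI hn0).
  apply: etrans (esym E1) _; apply: etrans _ E2.
  by rewrite (addrCA (h *: w)) -!addrA; congr (_ + _); rewrite !opprD !opprK addrCA.
have [_ _ A1] := rP _ (inb w v s t bM2 sh th).
have [_ A2 _] := rP _ (inb v w s' t' bM1 sh' th').
have key (a b c d : R) : `|a - c| < e -> `|b - d| < e -> d = c -> `|a - b| < e + e.
  move=> ac bd dc; rewrite (_ : a - b = (a - c) - (b - d)); last by rewrite dc; ring.
  by apply: le_lt_trans (ler_normB _ _) _; apply: ltrD.
have := key _ _ _ _ A2 A1 E.
by rewrite eE ltxx.
Qed.

Lemma derive_at_max U f x v : open U -> U x -> Ck_on 1 U f ->
  (forall y, U y -> f y <= f x) -> 'D_v f x = 0.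
Proof.
move=> oU Ux cf fmax.
pose l (s : R) := s *: v + x.
have cl : {for (0 : R), continuous l}.
  apply: (@continuousD _ _ _ (fun s : R => s *: v) (fun=> x)); last exact: cvg_cst.
  exact: scalel_continuous.
have /nbhs_ballP[r /= r0 rP] : \forall s \near (0 : R), U (l s).
  apply: (cl U); apply: open_nbhs_nbhs; split=> //.
  by rewrite /l scale0r add0r.
have inb (s : R) : s \in `]-r, r[ -> U (l s).
  rewrite in_itv /= => /andP[a b]; apply: rP.
  by rewrite -ball_normE /ball_ /= sub0r normrN ltr_norml a b.
have der (s : R) : s \in `]-r, r[ -> is_derive s 1 (fun s : R => f (l s)) ('D_v f (l s)).
  by move=> /inb Us; apply: derive_line; apply: Ck_on_derivable cf Us.
have in0 : 0 \in `]-r, r[ by rewrite in_itv /= oppr_lt0 r0.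
have l0 : l 0 = x by rewrite /l scale0r add0r.
have [] := @derive1_at_max _ (fun s : R => f (l s)) (-r) r 0 _ _ in0 _.
- by rewrite ge0_cp // ltW.
- by move=> s /der [].
- by move=> s /inb Us; rewrite l0; apply: fmax.
by move=> _; case: (der 0 in0) => _ ->; rewrite l0.
Qed.

End SmoothReal.

(** * Complex derivatives *)

(** Identities behind the rules for dz and dzbar, with c standing for i or -i
    and h for 1/2; over an abstract ring, normalisation does not unfold the
    operations of R[i]. *)
Section WirtingerAlgebra.
Context (F : comNzRingType).
Implicit Types a b c h : F.

Lemma wirtinger_add a a' b b' c h :
  (a + a' + c * (b + b')) * h = (a + c * b) * h + (a' + c * b') * h.
Proof. by ring. Qed.

Lemma wirtinger_mul a a' b b' c h f g :
  (a * g + f * a' + c * (b * g + f * b')) * h =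
  (a + c * b) * h * g + f * ((a' + c * b') * h).
Proof. by ring. Qed.

Lemma wirtinger_scale a b c h z :
  (z * a + c * (z * b)) * h = z * ((a + c * b) * h).
Proof. by ring. Qed.

Lemma wirtinger_opp a b c h : (- a + c * (- b)) * h = - ((a + c * b) * h).
Proof. by ring. Qed.

Lemma wirtinger_chain a a' b b' c h p q :
  (a * p + a' * q + c * (b * p + b' * q)) * h =
  (a + c * b) * h * p + (a' + c * b') * h * q.
Proof. by ring. Qed.

Lemma wirtinger_expand a b c p q :
  a * (p + q) + b * (c * (p - q)) = (a + c * b) * p + (a + - c * b) * q.
Proof. by ring. Qed.

End WirtingerAlgebra.

Section WirtingerInverse.
Context (F : numFieldType).
Implicit Types a b c : F.

Lemma wirtinger_ex a b c : a = (a + - c * b) / 2 + (a + c * b) / 2.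
Proof. by field. Qed.

Lemma wirtinger_ey a b c : c * c = -1 -> b = c * ((a + - c * b) / 2 - (a + c * b) / 2).
Proof.
move=> cc; transitivity (- (c * c) * b); first by rewrite cc opprK mul1r.
by field.
Qed.

End WirtingerInverse.

Section SmoothComplex.
Context (R : realType) (n : nat).
Local Notation E := (cspace R n).
Local Notation C := R[i].
Implicit Types (U : set E) (f g : E -> C) (u : E -> R) (x v w : E) (k : 'I_n).

Lemma smooth_derivable U u x v : smooth_on U u -> U x -> derivable u x v.
Proof. by move=> /(_ 1%N) /Ck_on_derivable; apply. Qed.

Lemma smooth_derive U u v : smooth_on U u -> smooth_on U ('D_v u).
Proof. by move=> su m; apply: Ck_on_derive. Qed.

Lemma smooth_eq U u u' : open U -> (forall x, U x -> u x = u' x) ->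
  smooth_on U u -> smooth_on U u'.
Proof.
by move=> oU uu' su m; apply: Ck_on_eq (su m) => // x; rewrite inE; apply: uu'.
Qed.

Lemma smoothD U u u' : open U -> smooth_on U u -> smooth_on U u' ->
  smooth_on U (fun x => u x + u' x).
Proof. by move=> oU su su' m; apply: Ck_onD. Qed.

Lemma smoothM U u u' : open U -> smooth_on U u -> smooth_on U u' ->
  smooth_on U (fun x => u x * u' x).
Proof. by move=> oU su su' m; apply: Ck_onM. Qed.

Lemma smooth_cst U (c : R) : smooth_on U (fun=> c).
Proof. by move=> m; apply: Ck_on_cst. Qed.

Lemma smoothN U u : open U -> smooth_on U u -> smooth_on U (fun x => - u x).
Proof.
move=> oU su; apply: (@smooth_eq _ (fun x => -1 * u x)) => // [x _|].
  by rewrite mulN1r.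
by apply: smoothM => //; apply: smooth_cst.
Qed.

Lemma ReD (a b : C) : complex.Re (a + b) = complex.Re a + complex.Re b.
Proof. by case: a b => [? ?] [? ?]. Qed.
Lemma ImD (a b : C) : complex.Im (a + b) = complex.Im a + complex.Im b.
Proof. by case: a b => [? ?] [? ?]. Qed.
Lemma ReN (a : C) : complex.Re (- a) = - complex.Re a.
Proof. by case: a. Qed.
Lemma ImN (a : C) : complex.Im (- a) = - complex.Im a.
Proof. by case: a. Qed.
Lemma ReM (a b : C) : complex.Re (a * b) =
  complex.Re a * complex.Re b + - (complex.Im a * complex.Im b).
Proof. by case: a b => [? ?] [? ?]. Qed.
Lemma ImM (a b : C) : complex.Im (a * b) =
  complex.Re a * complex.Im b + complex.Im a * complex.Re b.
Proof. by case: a b => [? ?] [? ?]. Qed.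
Lemma ReJ (a : C) : complex.Re (a^*) = complex.Re a. Proof. by case: a. Qed.
Lemma ImJ (a : C) : complex.Im (a^*) = - complex.Im a. Proof. by case: a. Qed.
Lemma complexP (a b : C) : complex.Re a = complex.Re b ->
  complex.Im a = complex.Im b -> a = b.
Proof. by case: a b => [? ?] [? ?] /= -> ->. Qed.
Lemma iC2 : iC R * iC R = -1.
Proof. by rewrite -expr2; exact: sqr_i. Qed.
Lemma iCJ : (iC R)^* = - iC R.
Proof. by apply: complexP; rewrite /= ?oppr0. Qed.

Lemma csmooth_eq U f g : open U -> (forall x, U x -> f x = g x) ->
  csmooth_on U f -> csmooth_on U g.
Proof.
move=> oU fg [sr si].
by split; [apply: smooth_eq sr | apply: smooth_eq si] => // x Ux; rewrite fg.
Qed.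

Lemma csmooth_sub U U' f : U `<=` U' -> csmooth_on U' f -> csmooth_on U f.
Proof. by move=> sUU' [sr si]; split=> m; apply: Ck_on_sub sUU' _. Qed.

Lemma csmooth_cst U (c : C) : csmooth_on U (fun=> c).
Proof. by split; apply: smooth_cst. Qed.

Lemma csmoothD U f g : open U -> csmooth_on U f -> csmooth_on U g ->
  csmooth_on U (fun x => f x + g x).
Proof.
move=> oU [fr fi] [gr gi]; split.
  by apply: smooth_eq (smoothD oU fr gr) => // x _; rewrite ReD.
by apply: smooth_eq (smoothD oU fi gi) => // x _; rewrite ImD.
Qed.

Lemma csmoothN U f : open U -> csmooth_on U f -> csmooth_on U (fun x => - f x).
Proof.
move=> oU [fr fi]; split.
  by apply: smooth_eq (smoothN oU fr) => // x _; rewrite ReN.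
by apply: smooth_eq (smoothN oU fi) => // x _; rewrite ImN.
Qed.

Lemma csmoothM U f g : open U -> csmooth_on U f -> csmooth_on U g ->
  csmooth_on U (fun x => f x * g x).
Proof.
move=> oU [fr fi] [gr gi]; split.
  apply: smooth_eq (smoothD oU (smoothM oU fr gr) (smoothN oU (smoothM oU fi gi))) => //.
  by move=> x _; rewrite ReM.
apply: smooth_eq (smoothD oU (smoothM oU fr gi) (smoothM oU fi gr)) => //.
by move=> x _; rewrite ImM.
Qed.

Lemma csmoothJ U f : open U -> csmooth_on U f -> csmooth_on U (fun x => (f x)^*).
Proof.
move=> oU [fr fi]; split.
  by apply: smooth_eq fr => // x _; rewrite ReJ.
by apply: smooth_eq (smoothN oU fi) => // x _; rewrite ImJ.
Qed.

Lemma csmooth_real U u : smooth_on U u -> csmooth_on U (fun x => (u x)%:C).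
Proof. by split=> //; apply: smooth_cst. Qed.

(** The inverse is the conjugate divided by the squared modulus, a smooth real
    function. *)
Lemma csmoothV U f : open U -> (forall x, U x -> f x != 0) -> csmooth_on U f ->
  csmooth_on U (fun x => (f x)^-1).
Proof.
move=> oU fn0 sf; have [fr fi] := sf.
pose N x := complex.Re (f x) * complex.Re (f x) + complex.Im (f x) * complex.Im (f x).
have N0 x : U x -> N x != 0.
  move=> /fn0; apply: contraNneq; rewrite /N -!expr2 => /eqP.
  rewrite paddr_eq0 ?sqr_ge0// !sqrf_eq0 => /andP[/eqP a /eqP b].
  by apply/eqP; apply: complexP; rewrite ?a ?b.
have smooth_Nrm : smooth_on U (fun x => (N x)^-1).
  move=> m; apply: Ck_onV => //.
  exact: (smoothD oU (smoothM oU fr fr) (smoothM oU fi fi)).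
apply: csmooth_eq (csmoothM oU (csmoothJ oU sf) (csmooth_real smooth_Nrm)) => // x Ux.
have fx0 := fn0 x Ux; apply: (mulIf fx0); rewrite mulVf//.
rewrite mulrAC (_ : (f x)^* * f x = (N x)%:C).
  by rewrite -rmorphM /= mulfV ?N0.
by rewrite /N; case: (f x) => a b; apply: complexP => /=; ring.
Qed.

Lemma csmooth_sum U (I : Type) (r : seq I) (F : I -> E -> C) : open U ->
  (forall i, csmooth_on U (F i)) -> csmooth_on U (fun y => \sum_(i <- r) F i y).
Proof.
move=> oU sF; elim: r => [|i r IH].
  by apply: csmooth_eq (csmooth_cst U 0) => // x _; rewrite big_nil.
by apply: csmooth_eq (csmoothD oU (sF i) IH) => // x _; rewrite big_cons.
Qed.

Lemma csmooth_prod U (I : Type) (r : seq I) (F : I -> E -> C) : open U ->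
  (forall i, csmooth_on U (F i)) -> csmooth_on U (fun y => \prod_(i <- r) F i y).
Proof.
move=> oU sF; elim: r => [|i r IH].
  by apply: csmooth_eq (csmooth_cst U 1) => // x _; rewrite big_nil.
by apply: csmooth_eq (csmoothM oU (sF i) IH) => // x _; rewrite big_cons.
Qed.

Lemma csmooth_det U m (F : E -> 'M[C]_m) : open U ->
  (forall i j, csmooth_on U (fun y => F y i j)) ->
  csmooth_on U (fun y => \det (F y)).
Proof.
move=> oU sF; rewrite /determinant; apply: csmooth_sum => // s.
by apply: csmoothM => //; [exact: csmooth_cst|apply: csmooth_prod].
Qed.

(** By Cramer's rule. *)
Lemma csmooth_invmx U m (F : E -> 'M[C]_m) i j : open U ->
  (forall x, U x -> F x \in unitmx) ->
  (forall i j, csmooth_on U (fun y => F y i j)) ->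
  csmooth_on U (fun y => invmx (F y) i j).
Proof.
move=> oU Fu sF.
apply: (@csmooth_eq _ (fun y => (\det (F y))^-1 * cofactor (F y) j i)) => //.
  by move=> x Ux; rewrite /invmx (Fu x Ux) !mxE.
apply: csmoothM => //.
  by apply: csmoothV => //; apply: csmooth_det.
rewrite /cofactor; apply: csmoothM => //; first exact: csmooth_cst.
apply: csmooth_det => // a b.
by apply: csmooth_eq (sF (lift j a) (lift i b)) => // x _; rewrite !mxE.
Qed.

Lemma csmooth_cD U f v : csmooth_on U f -> csmooth_on U (cD v f).
Proof. by move=> [fr fi]; split; apply: smooth_derive. Qed.

Lemma csmooth_dz U f k : open U -> csmooth_on U f -> csmooth_on U (dz k f).
Proof.
move=> oU sf; apply: csmoothM => //; last exact: csmooth_cst.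
apply: csmoothD => //; first exact: csmooth_cD.
by apply: csmoothN => //; apply: csmoothM => //; [exact: csmooth_cst|exact: csmooth_cD].
Qed.

Lemma csmooth_dzbar U f k : open U -> csmooth_on U f -> csmooth_on U (dzbar k f).
Proof.
move=> oU sf; apply: csmoothM => //; last exact: csmooth_cst.
apply: csmoothD => //; first exact: csmooth_cD.
by apply: csmoothM => //; [exact: csmooth_cst|exact: csmooth_cD].
Qed.

Lemma dzE k f x : dz k f x = (cD (ex R k) f x + (- iC R) * cD (ey R k) f x) / 2.
Proof. by rewrite /dz mulNr. Qed.

Lemma cD_eq U f g v x : open U -> U x -> (forall y, U y -> f y = g y) ->
  cD v f x = cD v g x.
Proof.
move=> oU Ux fg; rewrite /cD; congr (_ +i* _); apply: near_eq_derive;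
  by apply: near_open Ux _ => // y Uy; rewrite fg.
Qed.

Lemma cD_cst (c : C) v x : cD v (fun=> c) x = 0.
Proof. by rewrite /cD !derive_cst. Qed.

Section Derivations.
Variables (U : set E) (x : E).
Hypothesis Ux : U x.

Lemma cDD f g v : csmooth_on U f -> csmooth_on U g ->
  cD v (fun y => f y + g y) x = cD v f x + cD v g x.
Proof.
move=> [fr fi] [gr gi]; have D (u : E -> R) (su : smooth_on U u) := @smooth_derivable U u x v su Ux.
apply: complexP; rewrite ?ReD ?ImD /=.
  under eq_fun do rewrite ReD.
  exact: derive_add (D _ fr) (D _ gr).
under eq_fun do rewrite ImD.
exact: derive_add (D _ fi) (D _ gi).
Qed.

Lemma cDM f g v : csmooth_on U f -> csmooth_on U g ->
  cD v (fun y => f y * g y) x = cD v f x * g x + f x * cD v g x.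
Proof.
move=> [fr fi] [gr gi]; have D (u : E -> R) (su : smooth_on U u) := @smooth_derivable U u x v su Ux.
have DM (a b : E -> R) (Da : derivable a x v) (Db : derivable b x v) :
  derivable (fun y => a y * b y) x v := derivableM Da Db.
apply: complexP; rewrite ?ReD ?ImD ?ReM ?ImM /=.
  under eq_fun do rewrite ReM.
  rewrite (derive_add (DM _ _ (D _ fr) (D _ gr)) (derivableN (DM _ _ (D _ fi) (D _ gi)))).
  rewrite (derive_opp (DM _ _ (D _ fi) (D _ gi))).
  rewrite (derive_mul (D _ fr) (D _ gr)) (derive_mul (D _ fi) (D _ gi)).
  by ring.
under eq_fun do rewrite ImM.
rewrite (derive_add (DM _ _ (D _ fr) (D _ gi)) (DM _ _ (D _ fi) (D _ gr))).
rewrite (derive_mul (D _ fr) (D _ gi)) (derive_mul (D _ fi) (D _ gr)).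
by ring.
Qed.

Lemma cDJ f v : csmooth_on U f -> cD v (fun y => (f y)^*) x = (cD v f x)^*.
Proof.
move=> [fr fi]; have D (u : E -> R) (su : smooth_on U u) := @smooth_derivable U u x v su Ux.
apply: complexP => /=; first by under eq_fun do rewrite ReJ.
under eq_fun do rewrite ImJ.
exact: derive_opp (D _ fi).
Qed.

Lemma cDZ (c : C) f v : csmooth_on U f -> cD v (fun y => c * f y) x = c * cD v f x.
Proof. by move=> sf; rewrite (cDM v (csmooth_cst U c) sf) cD_cst mul0r add0r. Qed.

Lemma cDN f v : csmooth_on U f -> cD v (fun y => - f y) x = - cD v f x.
Proof.
move=> [fr fi]; have D (u : E -> R) (su : smooth_on U u) := @smooth_derivable U u x v su Ux.
apply: complexP; rewrite ?ReN ?ImN /=.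
  by under eq_fun do rewrite ReN; exact: derive_opp (D _ fr).
by under eq_fun do rewrite ImN; exact: derive_opp (D _ fi).
Qed.

Lemma dzD f g k : csmooth_on U f -> csmooth_on U g ->
  dz k (fun y => f y + g y) x = dz k f x + dz k g x.
Proof. by move=> sf sg; rewrite !dzE !cDD// wirtinger_add. Qed.

Lemma dzbarD f g k : csmooth_on U f -> csmooth_on U g ->
  dzbar k (fun y => f y + g y) x = dzbar k f x + dzbar k g x.
Proof. by move=> sf sg; rewrite /dzbar !cDD// wirtinger_add. Qed.

Lemma dzM f g k : csmooth_on U f -> csmooth_on U g ->
  dz k (fun y => f y * g y) x = dz k f x * g x + f x * dz k g x.
Proof. by move=> sf sg; rewrite !dzE !cDM// wirtinger_mul. Qed.

Lemma dzbarM f g k : csmooth_on U f -> csmooth_on U g ->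
  dzbar k (fun y => f y * g y) x = dzbar k f x * g x + f x * dzbar k g x.
Proof. by move=> sf sg; rewrite /dzbar !cDM// wirtinger_mul. Qed.

Lemma dzZ (c : C) f k : csmooth_on U f -> dz k (fun y => c * f y) x = c * dz k f x.
Proof. by move=> sf; rewrite !dzE !cDZ// wirtinger_scale. Qed.

Lemma dzbarZ (c : C) f k : csmooth_on U f ->
  dzbar k (fun y => c * f y) x = c * dzbar k f x.
Proof. by move=> sf; rewrite /dzbar !cDZ// wirtinger_scale. Qed.

Lemma dzN f k : csmooth_on U f -> dz k (fun y => - f y) x = - dz k f x.
Proof. by move=> sf; rewrite !dzE !cDN// wirtinger_opp. Qed.

Lemma dzbarN f k : csmooth_on U f -> dzbar k (fun y => - f y) x = - dzbar k f x.
Proof. by move=> sf; rewrite /dzbar !cDN// wirtinger_opp. Qed.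

Lemma dzJ f k : csmooth_on U f -> dz k (fun y => (f y)^*) x = (dzbar k f x)^*.
Proof.
move=> sf; rewrite dzE /dzbar !cDJ// rmorphM rmorphD rmorphM /= iCJ.
by rewrite fmorphV /= rmorph_nat.
Qed.

Lemma dzbarJ f k : csmooth_on U f -> dzbar k (fun y => (f y)^*) x = (dz k f x)^*.
Proof.
move=> sf; rewrite dzE /dzbar !cDJ// rmorphM rmorphD rmorphM /= rmorphN /= iCJ opprK.
by rewrite fmorphV /= rmorph_nat.
Qed.

End Derivations.

Lemma dz_cst (c : C) k x : dz k (fun=> c) x = 0.
Proof. by rewrite /dz !cD_cst mulr0 subrr mul0r. Qed.

Lemma dzbar_cst (c : C) k x : dzbar k (fun=> c) x = 0.
Proof. by rewrite /dzbar !cD_cst mulr0 addr0 mul0r. Qed.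

Lemma dz_eq U f g k x : open U -> U x -> (forall y, U y -> f y = g y) ->
  dz k f x = dz k g x.
Proof. by move=> oU Ux fg; rewrite /dz !(cD_eq _ oU Ux fg). Qed.

Lemma dzbar_eq U f g k x : open U -> U x -> (forall y, U y -> f y = g y) ->
  dzbar k f x = dzbar k g x.
Proof. by move=> oU Ux fg; rewrite /dzbar !(cD_eq _ oU Ux fg). Qed.

Section Commutation.
Variables (U : set E) (x : E).
Hypotheses (oU : open U) (Ux : U x).

Lemma dz_sum (I : Type) (r : seq I) (F : I -> E -> C) k :
  (forall i, csmooth_on U (F i)) ->
  dz k (fun y => \sum_(i <- r) F i y) x = \sum_(i <- r) dz k (F i) x.
Proof.
move=> sF; elim: r => [|i r IH].
  rewrite big_nil; apply: etrans (dz_cst 0 k x); apply: dz_eq oU Ux _ => y _.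
  by rewrite big_nil.
rewrite big_cons -IH -(dzD Ux _ (sF i) (csmooth_sum r oU sF)).
by apply: dz_eq oU Ux _ => y _; rewrite big_cons.
Qed.

Lemma dzbar_sum (I : Type) (r : seq I) (F : I -> E -> C) k :
  (forall i, csmooth_on U (F i)) ->
  dzbar k (fun y => \sum_(i <- r) F i y) x = \sum_(i <- r) dzbar k (F i) x.
Proof.
move=> sF; elim: r => [|i r IH].
  rewrite big_nil; apply: etrans (dzbar_cst 0 k x); apply: dzbar_eq oU Ux _ => y _.
  by rewrite big_nil.
rewrite big_cons -IH -(dzbarD Ux _ (sF i) (csmooth_sum r oU sF)).
by apply: dzbar_eq oU Ux _ => y _; rewrite big_cons.
Qed.

Lemma cD_comm f v w : csmooth_on U f -> cD v (cD w f) x = cD w (cD v f) x.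
Proof.
move=> [fr fi]; apply: complexP => /=.
  exact: (schwarz v w oU Ux (fr 2%N)).
exact: (schwarz v w oU Ux (fi 2%N)).
Qed.

Lemma cD_dzbar f v k : csmooth_on U f -> cD v (dzbar k f) x = dzbar k (cD v f) x.
Proof.
move=> sf; have sD w := csmooth_cD w sf.
have sM c w : csmooth_on U (fun y => c * cD w f y).
  by apply: csmoothM => //; exact: csmooth_cst.
rewrite /dzbar -(cD_comm v (ex R k) sf) -(cD_comm v (ey R k) sf) mulrC.
rewrite (cD_eq (g := fun y => 2^-1 * (cD (ex R k) f y + iC R * cD (ey R k) f y)) _ oU Ux).
  by rewrite (cDZ Ux _ _ (csmoothD oU (sD _) (sM _ _))) (cDD Ux _ (sD _) (sM _ _)) (cDZ Ux _ _ (sD _)).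
by move=> y _; rewrite /dzbar mulrC.
Qed.

Lemma dz_dzbar_comm f i j : csmooth_on U f ->
  dz i (dzbar j f) x = dzbar j (dz i f) x.
Proof.
move=> sf; have sD w := csmooth_cD w sf.
rewrite dzE (cD_dzbar (ex R i) j sf) (cD_dzbar (ey R i) j sf) mulrC.
have sM c w : csmooth_on U (fun y => c * cD w f y).
  by apply: csmoothM => //; exact: csmooth_cst.
rewrite (dzbar_eq (f := dz i f)
  (g := fun y => 2^-1 * (cD (ex R i) f y + (- iC R) * cD (ey R i) f y)) _ oU Ux).
  rewrite (dzbarZ Ux _ _ (csmoothD oU (sD _) (sM _ _))).
  by rewrite (dzbarD Ux _ (sD _) (sM _ _)) (dzbarZ Ux _ _ (sD _)).
by move=> y _; rewrite dzE mulrC.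
Qed.

End Commutation.

Lemma halfJ : (2^-1 : C)^* = 2^-1.
Proof. by rewrite fmorphV /= rmorph_nat. Qed.

Lemma dz_conjE k f x :
  (dz k f x)^* = ((cD (ex R k) f x)^* + iC R * (cD (ey R k) f x)^*) / 2.
Proof. by rewrite dzE rmorphM rmorphD rmorphM rmorphN /= iCJ opprK halfJ. Qed.

Lemma dzbar_conjE k f x :
  (dzbar k f x)^* = ((cD (ex R k) f x)^* + - iC R * (cD (ey R k) f x)^*) / 2.
Proof. by rewrite /dzbar rmorphM rmorphD rmorphM /= iCJ halfJ. Qed.

Lemma cD_ex k f x : cD (ex R k) f x = dz k f x + dzbar k f x.
Proof. by rewrite dzE /dzbar; exact: wirtinger_ex. Qed.

Lemma cD_ey k f x : cD (ey R k) f x = iC R * (dz k f x - dzbar k f x).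
Proof. rewrite dzE /dzbar; exact: wirtinger_ey iC2. Qed.

Lemma smooth_derive_coord U u x w : open U -> U x -> smooth_on U u ->
  'D_w u x = \sum_k (w.1 0 k * 'D_(ex R k) u x + w.2 0 k * 'D_(ey R k) u x).
Proof.
move=> oU Ux su; rewrite (derive_coord w oU Ux (su 1%N)) big_sumType /=.
by rewrite -big_split.
Qed.

Lemma Re_sum (I : Type) (r : seq I) (F : I -> C) :
  complex.Re (\sum_(i <- r) F i) = \sum_(i <- r) complex.Re (F i).
Proof. by elim/big_rec2: _ => // i a b _ <-; rewrite ReD. Qed.

Lemma Im_sum (I : Type) (r : seq I) (F : I -> C) :
  complex.Im (\sum_(i <- r) F i) = \sum_(i <- r) complex.Im (F i).
Proof. by elim/big_rec2: _ => // i a b _ <-; rewrite ImD. Qed.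

Lemma Re_lin (r s : R) (a b : C) :
  complex.Re (r%:C * a + s%:C * b) = r * complex.Re a + s * complex.Re b.
Proof. by case: a b => a a' [b b'] /=; rewrite !mul0r !subr0. Qed.

Lemma Im_lin (r s : R) (a b : C) :
  complex.Im (r%:C * a + s%:C * b) = r * complex.Im a + s * complex.Im b.
Proof. by case: a b => a a' [b b'] /=; rewrite !mul0r !addr0. Qed.

Lemma zcE k w : zc k w = (w.1 0 k)%:C + iC R * (w.2 0 k)%:C.
Proof. by apply: complexP; rewrite /= ?mul0r ?mul1r ?mulr0 ?subr0 ?add0r ?addr0. Qed.

Lemma zcJE k w : (zc k w)^* = (w.1 0 k)%:C + - iC R * (w.2 0 k)%:C.
Proof.
by rewrite zcE; apply: complexP;
  rewrite /= ?mulN1r ?mulNr ?mul0r ?mul1r ?mulr0 ?oppr0 ?subr0 ?add0r ?addr0 ?subr0.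
Qed.

(** The differential of f is the sum of its complex linear part, with
    coefficients dz, and its antilinear part, with coefficients dzbar. *)
Lemma cD_expand U f x w : open U -> U x -> csmooth_on U f ->
  cD w f x = \sum_k (zc k w * dz k f x + (zc k w)^* * dzbar k f x).
Proof.
move=> oU Ux [sr si].
have -> : cD w f x = \sum_k ((w.1 0 k)%:C * cD (ex R k) f x + (w.2 0 k)%:C * cD (ey R k) f x).
  apply: complexP; rewrite /= ?Re_sum ?Im_sum.
    rewrite (smooth_derive_coord w oU Ux sr); apply: eq_bigr => k _.
    exact: esym (Re_lin _ _ (cD (ex R k) f x) (cD (ey R k) f x)).
  rewrite (smooth_derive_coord w oU Ux si); apply: eq_bigr => k _.
  exact: esym (Im_lin _ _ (cD (ex R k) f x) (cD (ey R k) f x)).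
apply: eq_bigr => k _; rewrite cD_ex cD_ey.
rewrite zcJE zcE; exact: wirtinger_expand.
Qed.

Section Composition.
Variables (U U' : set E) (psi : E -> E).
Hypotheses (oU : open U) (oU' : open U') (UU' : forall x, U x -> U' (psi x)).
Hypothesis psiS : forall k, csmooth_on U (fun y => zc k (psi y)).

Let psi_coord m i : Ck_on m U (fun y => rcoord (psi y) i).
Proof. by case: i => k /=; have [a b] := psiS k; [exact: a | exact: b]. Qed.

Lemma csmooth_comp f : csmooth_on U' f -> csmooth_on U (fun y => f (psi y)).
Proof.
move=> [sr si]; split=> m.
  exact: (Ck_on_comp oU oU' UU' (psi_coord m) (sr m)).
exact: (Ck_on_comp oU oU' UU' (psi_coord m) (si m)).
Qed.

Lemma zc_derive x v k : U x -> zc k ('D_v psi x) = cD v (fun y => zc k (psi y)) x.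
Proof.
move=> Ux; have [_ ->] := differentiable_map oU Ux (psi_coord 1).
have H i : rcoord (\sum_i 'D_v (fun y => rcoord (psi y) i) x *: rbasis R i) i =
    'D_v (fun y => rcoord (psi y) i) x.
  set w : E := (\row_k 'D_v (fun y => rcoord (psi y) (inl k)) x,
            \row_k 'D_v (fun y => rcoord (psi y) (inr k)) x).
  have wE j : rcoord w j = 'D_v (fun y => rcoord (psi y) j) x.
    by case: j => j; rewrite /= mxE.
  rewrite -wE (_ : \sum_i _ = w) // [RHS]rcoord_rbasis.
  by apply: eq_bigr => j _; rewrite wE.
by apply: complexP; [exact: (H (inl k)) | exact: (H (inr k))].
Qed.

Lemma cD_comp f x v : U x -> csmooth_on U' f ->
  cD v (fun y => f (psi y)) x =
  \sum_k (cD v (fun y => zc k (psi y)) x * dz k f (psi x) +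
    (cD v (fun y => zc k (psi y)) x)^* * dzbar k f (psi x)).
Proof.
move=> Ux sf; have [sr si] := sf.
have H u : smooth_on U' u ->
    'D_v (fun y => u (psi y)) x = 'D_('D_v psi x) u (psi x).
  move=> su.
  have [_ ->] := derive_comp v oU Ux oU' (UU' Ux) (psi_coord 1) (su 1%N).
  rewrite (derive_coord _ oU' (UU' Ux) (su 1%N)); apply: eq_bigr => i _.
  by congr (_ * _); case: i => k;
    have := zc_derive v k Ux => /= -[] // a b; rewrite ?a ?b.
have -> : cD v (fun y => f (psi y)) x = cD ('D_v psi x) f (psi x).
  by apply: complexP => /=; [exact: (H _ sr) | exact: (H _ si)].
rewrite (cD_expand _ oU' (UU' Ux) sf); apply: eq_bigr => k _.
by rewrite zc_derive.
Qed.

Lemma dz_comp f x k : U x -> csmooth_on U' f ->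
  dz k (fun y => f (psi y)) x =
  \sum_j (dz k (fun y => zc j (psi y)) x * dz j f (psi x) +
    (dzbar k (fun y => zc j (psi y)) x)^* * dzbar j f (psi x)).
Proof.
move=> Ux sf; rewrite dzE !cD_comp// mulr_sumr -big_split mulr_suml.
apply: eq_bigr => j _; rewrite (dzE k (fun y => zc j (psi y))) dzbar_conjE.
exact: wirtinger_chain.
Qed.

Lemma dzbar_comp f x k : U x -> csmooth_on U' f ->
  dzbar k (fun y => f (psi y)) x =
  \sum_j (dzbar k (fun y => zc j (psi y)) x * dz j f (psi x) +
    (dz k (fun y => zc j (psi y)) x)^* * dzbar j f (psi x)).
Proof.
move=> Ux sf; rewrite {1}/dzbar !cD_comp// mulr_sumr -big_split mulr_suml.
apply: eq_bigr => j _; rewrite dz_conjE; exact: wirtinger_chain.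
Qed.

End Composition.

End SmoothComplex.

(** * Hermitian forms and their matrices *)

Section PosdefDet.
Context (C : numClosedFieldType).

(** In a unitary diagonalisation of A the diagonal entries are the values of
    the form on the rows of the unitary matrix. *)
Lemma det_posdef n (A : 'M[C]_n) : (forall i j, A i j = Num.conj (A j i)) ->
  (forall u : 'rV[C]_n, u != 0 ->
     0 < \sum_i \sum_j u 0 i * A i j * Num.conj (u 0 j)) ->
  0 < \det A.
Proof.
move=> Aherm Apos.
have /hermitian_normalmx/orthomx_spectralP : A \is hermitianmx _ false (@Num.conj C).
  apply/is_hermitianmxP; rewrite expr0 scale1r.
  by apply/matrixP => i j; rewrite !mxE Aherm.
set P := spectralmx A; set d := spectral_diag A => AE.
have uP : P \is unitarymx := spectral_unitarymx A.
have Pu := unitarymx_unit uP.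
have PAP : P *m A *m (map_mx (@Num.conj C) P^T) = diag_mx d.
  by rewrite -(invmx_unitary uP) {1}AE !mulmxA mulmxV// mul1mx mulmxK.
have d0 i : 0 < d 0 i.
  have := Apos (row i P); have -> : \sum_k \sum_j row i P 0 k * A k j * Num.conj (row i P 0 j)
     = d 0 i.
    transitivity ((P *m A *m (map_mx (@Num.conj C) P^T)) i i).
      rewrite !mxE; under [RHS]eq_bigr do rewrite !mxE mulr_suml.
      by rewrite exchange_big; apply: eq_bigr => k _; apply: eq_bigr => j _; rewrite !mxE.
    by rewrite PAP !mxE eqxx.
  apply; apply/eqP => r0; have : row_free P by rewrite row_free_unit.
  move/row_freeP => [Q PQ]; have := congr1 (row i) PQ.
  rewrite row_mul r0 mul0mx => /rowP/(_ i); rewrite !mxE eqxx => /esym/eqP.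
  by rewrite oner_eq0.
rewrite AE !det_mulmx det_diag mulrAC -det_mulmx mulVmx// det1 mul1r.
by apply: prodr_gt0.
Qed.

End PosdefDet.

Lemma quarter_double (F : numFieldType) (z : F) : z = 2 * (2 * z / 4).
Proof. by field. Qed.

Section HermitianForm.
Context (R : realType) (n : nat).
Local Notation E := (cspace R n).
Local Notation C := R[i].
Variable b : E -> E -> R.
Hypothesis b_lin : forall (c : R) v v' w, b (c *: v + v') w = c * b v w + b v' w.
Hypothesis b_sym : forall v w, b v w = b w v.
Hypothesis b_J : forall v w, b (mulJ v) (mulJ w) = b v w.

Lemma mulJ_ex k : mulJ (ex R k) = ey R k :> E.
Proof. by rewrite /mulJ /ex /ey /= oppr0. Qed.

Lemma mulJJ (v : E) : mulJ (mulJ v) = - v.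
Proof. by case: v. Qed.

(** With s = i this expands complex linear functions, with s = -i antilinear
    ones. *)
Lemma complex_linear_expand (L : E -> C) (s : C) :
  (forall (c : R) v w, L (c *: v + w) = c%:C * L v + L w) ->
  (forall v, L (mulJ v) = s * L v) ->
  forall v, L v = \sum_k ((v.1 0 k)%:C + s * (v.2 0 k)%:C) * L (ex R k).
Proof.
move=> Llin LJ v.
have L0 : L 0 = 0 by have := Llin (-1) 0 0; rewrite scaler0 addr0 rmorphN1 mulN1r addNr.
have LE (r : seq ('I_n + 'I_n)) : L (\sum_(i <- r) rcoord v i *: rbasis R i) =
    \sum_(i <- r) (rcoord v i)%:C * L (rbasis R i).
  elim: r => [|i r IH]; first by rewrite !big_nil.
  by rewrite !big_cons Llin IH.
rewrite {1}(rcoord_rbasis v) LE big_sumType /= -big_split; apply: eq_bigr => k _ /=.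
by rewrite -mulJ_ex LJ; ring.
Qed.

(** Twice the Hermitian form whose real part is b / 2: it is complex linear in
    v and antilinear in w ([hform_mulJl], [hform_mulJr]). *)
Definition hform v w : C := (b v w)%:C + iC R * (b v (mulJ w))%:C.

Lemma b_linr (c : R) v w w' : b v (c *: w + w') = c * b v w + b v w'.
Proof. by rewrite b_sym b_lin !(b_sym v). Qed.

Lemma b_opp v w : b (- v) w = - b v w.
Proof.
have b0 : b 0 w = 0 by have := b_lin (-1) 0 0 w; rewrite scaler0 addr0 mulN1r addNr.
by have := b_lin (-1) v 0 w; rewrite addr0 scaleN1r b0 addr0 mulN1r.
Qed.

Lemma b_mulJl v w : b (mulJ v) w = - b v (mulJ w).
Proof. by rewrite -b_J mulJJ b_opp. Qed.

Lemma mulJ_lin (c : R) (v w : E) : mulJ (c *: v + w) = c *: mulJ v + mulJ w.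
Proof.
by rewrite /mulJ; apply: cspace_eq => //=; rewrite opprD scalerN.
Qed.

Lemma hform_linl (c : R) v v' w : hform (c *: v + v') w = c%:C * hform v w + hform v' w.
Proof. by rewrite /hform !b_lin !rmorphD !rmorphM /=; ring. Qed.

Lemma hform_linr (c : R) v w w' : hform v (c *: w + w') = c%:C * hform v w + hform v w'.
Proof. by rewrite /hform mulJ_lin !b_linr !rmorphD !rmorphM /=; ring. Qed.

Lemma hform_mulJl v w : hform (mulJ v) w = iC R * hform v w.
Proof.
rewrite /hform b_mulJl b_J; apply: complexP => /=;
by rewrite ?(mul0r, mul1r, mulr0, mulr1, subr0, addr0, add0r, sub0r, oppr0).
Qed.

Lemma hform_mulJr v w : hform v (mulJ w) = - iC R * hform v w.
Proof.
rewrite /hform mulJJ (b_sym v (- w)) b_opp (b_sym w); apply: complexP => /=;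
by rewrite ?(mulNr, mul0r, mul1r, mulr0, mulr1, subr0, addr0, add0r, sub0r, oppr0, opprK).
Qed.

(** For a J-invariant b the four terms in the definition of [herm_mx] pair up
    to twice the value of the Hermitian form. *)
Lemma hform_ex i j : hform (ex R i) (ex R j) = 2 * herm_mx b i j.
Proof.
rewrite mxE -!mulJ_ex b_J b_mulJl opprK /hform.
set p := b _ _; set q := b _ _.
have -> : ((p + p) +i* (q + q)) = 2 * (p%:C + iC R * q%:C).
  rewrite mulr_natl mulr2n; apply: complexP => /=;
  by rewrite ?(mul0r, mul1r, mulr0, mulr1, subr0, addr0, add0r, sub0r, oppr0, opprK).
move: (p%:C + _) => z; exact: quarter_double.
Qed.

Lemma hform_mx v w :
  hform v w = 2 * \sum_i \sum_j zc i v * (zc j w)^* * herm_mx b i j.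
Proof.
rewrite (@complex_linear_expand (hform ^~ w) (iC R)); first last.
- by move=> u; rewrite hform_mulJl.
- by move=> c u u'; rewrite hform_linl.
rewrite mulr_sumr; apply: eq_bigr => i _ /=.
rewrite (@complex_linear_expand (hform (ex R i)) (- iC R)); first last.
- by move=> u; rewrite hform_mulJr.
- by move=> c u u'; rewrite hform_linr.
rewrite !mulr_sumr; apply: eq_bigr => j _; rewrite -zcE -zcJE hform_ex.
by rewrite mulrA mulrCA.
Qed.

Lemma b_hform v w : (b v w)%:C = (hform v w + (hform v w)^*) / 2.
Proof.
rewrite -ReJ_add; congr (_%:C); rewrite /hform /=.
by rewrite !mul0r mulr0 subr0 addr0.
Qed.

Lemma hformJ v w : (hform v w)^* = hform w v.
Proof.
rewrite /hform (b_sym w v) (b_sym w (mulJ v)) b_mulJl.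
apply: complexP => /=;
by rewrite ?(mul0r, mul1r, mulr0, mulr1, subr0, addr0, add0r, sub0r, oppr0, opprK).
Qed.

Lemma herm_mx_hermitian i j : (herm_mx b j i)^* = herm_mx b i j.
Proof.
have two : (2 : C) != 0 by rewrite pnatr_eq0.
by apply: (mulfI two); rewrite -hform_ex -hformJ hform_ex rmorphM /= rmorph_nat.
Qed.

Hypothesis b_pos : forall v, v != 0 -> 0 < b v v.

Lemma herm_mx_posdef (u : 'rV[C]_n) : u != 0 ->
  0 < \sum_i \sum_j u 0 i * (herm_mx b i j) * (u 0 j)^*.
Proof.
move=> u0; pose v : E := (\row_k complex.Re (u 0 k), \row_k complex.Im (u 0 k)).
have zv k : zc k v = u 0 k by apply: complexP; rewrite /= mxE.
have v0 : v != 0.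
  apply: contra_neq u0 => v0; apply/rowP => k; rewrite mxE -zv v0.
  by apply: complexP; rewrite /= mxE.
have bv : b v (mulJ v) = 0.
  have := b_mulJl v v; rewrite b_sym => /eqP.
  by rewrite -addr_eq0 -mulr2n mulrn_eq0 /= => /eqP.
have := hform_mx v v; rewrite {1}/hform bv rmorph0 mulr0 addr0.
under eq_bigr do under eq_bigr do rewrite !zv mulrAC.
move=> H; rewrite -(pmulr_rgt0 _ (ltr0Sn _ 1)) -H.
by rewrite ltcR b_pos.
Qed.

Lemma herm_mx_det : 0 < \det (herm_mx b).
Proof.
apply: det_posdef => [i j|u u0].
  by rewrite -herm_mx_hermitian.
exact: herm_mx_posdef.
Qed.

End HermitianForm.

(** * Logarithmic derivatives of determinants *)

Section Jacobi.
Context (R : realType) (n : nat).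
Local Notation E := (cspace R n).
Local Notation C := R[i].
Variables (U : set E) (oU : open U).

(** The terms are written as products over all of r, so that in [dz_det] each
    of them is a term of the Leibniz expansion of a determinant. *)
Lemma dz_prod (I : eqType) (r : seq I) (F : I -> E -> C) k x : U x -> uniq r ->
  (forall i, csmooth_on U (F i)) ->
  dz k (fun y => \prod_(i <- r) F i y) x =
  \sum_(i <- r) \prod_(j <- r) (if j == i then dz k (F j) x else F j x).
Proof.
move=> Ux + sF; elim: r => [_|i r IH /= /andP[ir ur]].
  rewrite big_nil; apply: etrans (dz_cst 1 k x).
  by apply: dz_eq oU Ux _ => y _; rewrite big_nil.
rewrite big_cons; transitivity (dz k (fun y => F i y * \prod_(j <- r) F j y) x).
  by apply: dz_eq oU Ux _ => y _; rewrite big_cons.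
rewrite (dzM Ux _ (sF i) (csmooth_prod r oU sF)) (IH ur) big_cons eqxx; congr (_ + _).
  congr (_ * _); apply: eq_big_seq => j jr.
  by case: eqP => // ji; rewrite -ji jr in ir.
rewrite mulr_sumr; apply: eq_big_seq => j jr; rewrite big_cons.
by case: eqP => // ij; rewrite ij jr in ir.
Qed.

(** Jacobi's formula: differentiating the Leibniz expansion gives the
    determinants in which one row of G is replaced by its derivative; expand
    each of them along that row. *)
Lemma dz_det (G : E -> 'M[C]_n) k x : U x ->
  (forall i j, csmooth_on U (fun y => G y i j)) ->
  dz k (fun y => \det (G y)) x =
  \sum_i \sum_j dz k (fun y => G y i j) x * cofactor (G x) i j.
Proof.
move=> Ux sG.
have sprod (s : 'I_n -> 'I_n) : csmooth_on U (fun y => \prod_i G y i (s i)).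
  exact: csmooth_prod.
rewrite /determinant (dz_sum oU Ux); last first.
  by move=> s; apply: csmoothM => //; exact: csmooth_cst.
have E1 i : \sum_j dz k (fun y => G y i j) x * cofactor (G x) i j =
   \det (\matrix_(i', j) if i' == i then dz k (fun y => G y i' j) x else G x i' j).
  rewrite (expand_det_row _ i); apply: eq_bigr => j _; rewrite mxE eqxx.
  congr (_ * _); rewrite /cofactor; congr (_ * _); congr (\det _).
  by apply/matrixP => i' j'; rewrite !mxE eq_sym (negPf (neq_lift _ _)).
under [RHS]eq_bigr do rewrite E1 /determinant.
rewrite exchange_big; apply: eq_bigr => s _ /=.
rewrite (dzZ Ux _ _ (sprod _)) -mulr_sumr; congr (_ * _).
rewrite (dz_prod _ Ux) ?index_enum_uniq//; apply: eq_bigr => i _; apply: eq_bigr => j _.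
by rewrite mxE.
Qed.

Lemma cD_ln (u : E -> R) v x : U x -> (forall x, U x -> 0 < u x) -> smooth_on U u ->
  cD v (fun y => (ln (u y))%:C) x = cD v (fun y => (u y)%:C) x / (u x)%:C.
Proof.
move=> Ux up su; have [_ E1] := derive_ln (up _ Ux) (smooth_derivable (v := v) su Ux).
have -> : cD v (fun y => (u y)%:C) x = ('D_v u x)%:C.
  by apply: complexP => /=; [|exact: derive_cst].
rewrite -fmorphV -rmorphM /= mulrC -E1.
by apply: complexP => /=; [|exact: derive_cst].
Qed.

Lemma dz_ln (u : E -> R) k x : U x -> (forall x, U x -> 0 < u x) -> smooth_on U u ->
  dz k (fun y => (ln (u y))%:C) x = dz k (fun y => (u y)%:C) x / (u x)%:C.
Proof. by move=> Ux up su; rewrite /dz !cD_ln// mulrA -mulrBl mulrAC. Qed.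

Lemma dzbar_ln (u : E -> R) k x : U x -> (forall x, U x -> 0 < u x) -> smooth_on U u ->
  dzbar k (fun y => (ln (u y))%:C) x = dzbar k (fun y => (u y)%:C) x / (u x)%:C.
Proof. by move=> Ux up su; rewrite /dzbar !cD_ln// mulrA -mulrDl mulrAC. Qed.

End Jacobi.

(** * Solitons in a holomorphic chart *)

Section LocalKaehler.
Context (R : realType) (n : nat).
Local Notation E := (cspace R n).
Local Notation C := R[i].
Variables (U : set E) (oU : open U) (G : E -> 'M[C]_n).
Hypothesis sG : forall i j, csmooth_on U (fun y => G y i j).
Hypothesis GH : forall x i j, U x -> (G x j i)^* = G x i j.
Hypothesis Gdet : forall x, U x -> 0 < \det (G x).

Definition logdet (G : E -> 'M[C]_n) (y : E) : C := (ln (complex.Re (\det (G y))))%:C.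
Definition ric (G : E -> 'M[C]_n) (x : E) : 'M[C]_n :=
  \matrix_(i, j) (- dz i (dzbar j (logdet G)) x).
(** The trace of the Ricci matrix with respect to G: half of the Riemannian
    scalar curvature. *)
Definition scal (G : E -> 'M[C]_n) (x : E) : C := \tr (invmx (G x) *m ric G x).

Lemma gt0_complex (z : C) : 0 < z -> z = (complex.Re z)%:C /\ 0 < complex.Re z.
Proof. by case: z => a b; rewrite ltcE /= => /andP[/eqP -> ->]. Qed.

Lemma posdet_unit x : U x -> G x \in unitmx.
Proof. by move=> /Gdet d0; rewrite unitmxE unitfE gt_eqF. Qed.

Let sdet : smooth_on U (fun y => complex.Re (\det (G y))).
Proof. exact: (csmooth_det oU sG).1. Qed.

Let det_gt0 x : U x -> 0 < complex.Re (\det (G x)).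
Proof. by move=> /Gdet/gt0_complex[]. Qed.

Lemma csmooth_logdet : csmooth_on U (logdet G).
Proof.
by apply: csmooth_real => m; apply: Ck_on_ln => //; apply: sdet.
Qed.

Lemma dz_logdet k x : U x -> dz k (logdet G) x =
  \sum_i \sum_j dz k (fun y => G y i j) x * invmx (G x) j i.
Proof.
move=> Ux; rewrite (dz_ln _ Ux det_gt0 sdet).
have -> : dz k (fun y => (complex.Re (\det (G y)))%:C) x = dz k (fun y => \det (G y)) x.
  by apply: dz_eq oU Ux _ => y Uy; have [] := gt0_complex (Gdet Uy).
rewrite (dz_det oU _ Ux sG) mulr_suml; apply: eq_bigr => i _.
rewrite mulr_suml; apply: eq_bigr => j _; rewrite -mulrA; congr (_ * _).
have [<- _] := gt0_complex (Gdet Ux).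
by rewrite /invmx (posdet_unit Ux) !mxE mulrC.
Qed.

(** log det G is real, and d_i commutes with dbar_j. *)
Lemma ric_herm x i j : U x -> (ric G x j i)^* = ric G x i j.
Proof.
have sL := csmooth_logdet.
move=> Ux; rewrite !mxE rmorphN /= -(dzbarJ Ux _ (csmooth_dzbar _ oU sL)).
congr (- _); rewrite (dz_dzbar_comm oU Ux _ _ sL).
apply: dzbar_eq oU Ux _ => y Uy; rewrite -(dzJ Uy _ sL).
by apply: dz_eq oU Uy _ => z _; exact: conjc_real.
Qed.

Lemma scal_real x : U x -> (scal G x)^* = scal G x.
Proof.
move=> Ux; rewrite /scal.
have conj_mx (f : {rmorphism C -> C}) (M : 'M[C]_n) :
  f (\tr M) = \tr (map_mx f M) by rewrite trace_map_mx.
rewrite (conj_mx conjc) map_mxM map_invmx.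
have -> : map_mx conjc (G x) = (G x)^T by apply/matrixP => i j; rewrite mxE [RHS]mxE; exact: GH.
have -> : map_mx conjc (ric G x) = (ric G x)^T.
  by apply/matrixP => i j; rewrite mxE [RHS]mxE; exact: ric_herm.
by rewrite -trmx_inv -trmx_mul mxtrace_tr mxtrace_mulC.
Qed.

Hypothesis GK : forall x i j k, U x ->
  dz k (fun y => G y i j) x = dz i (fun y => G y k j) x.

Section Soliton.
Variable V : E -> 'rV[C]_n.
Hypothesis sV : forall k, csmooth_on U (fun y => V y 0 k).
Hypothesis holV : forall i k x, U x -> dzbar i (fun y => V y 0 k) x = 0.

(** The (0,1)-form dual to V. *)
Definition flat l (y : E) : C := \sum_k V y 0 k * G y k l.

Lemma csmooth_flat l : csmooth_on U (flat l).
Proof. by apply: csmooth_sum => // k; apply: csmoothM. Qed.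

Hypothesis soliton : forall i j x, U x -> ric G x i j = G x i j + dz i (flat j) x.

(** The trace of the soliton equation.  Beside n, the trace of G^-1 d_i
    (V^k G_(k jbar)) has a part with derivatives of V, which is the
    coordinate divergence, and a part with derivatives of G, which by the
    Kaehler condition and Jacobi's formula is the derivative of log det G
    along V; together these two are the divergence of V. *)
Lemma scal_soliton x : U x ->
  scal G x = n%:R + \sum_i dz i (fun y => V y 0 i) x + \sum_k V x 0 k * dz k (logdet G) x.
Proof.
move=> Ux; have Gu := posdet_unit Ux.
have dflat i j : dz i (flat j) x = \sum_k dz i (fun y => V y 0 k) x * G x k j
   + \sum_k V x 0 k * dz k (fun y => G y i j) x.
  rewrite /flat (dz_sum oU Ux); last by move=> k; apply: csmoothM.
  rewrite -big_split; apply: eq_bigr => k _ /=.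
  by rewrite (dzM Ux _ (sV k) (sG _ _)) (GK _ _ _ Ux).
rewrite /scal; have -> : ric G x = G x + (\matrix_(i, k) dz i (fun y => V y 0 k) x) *m G x
   + \matrix_(i, j) \sum_k V x 0 k * dz k (fun y => G y i j) x.
  apply/matrixP => i j; rewrite soliton// dflat !mxE addrA; congr (_ + _ + _).
  by apply: eq_bigr => k _; rewrite mxE.
rewrite !mulmxDr !mxtraceD mulVmx// mxtrace1; congr (_ + _ + _).
  rewrite mxtrace_mulC -mulmxA mulmxV// mulmx1.
  by apply: eq_bigr => i _; rewrite mxE.
under [RHS]eq_bigr do rewrite dz_logdet//.
transitivity (\sum_j \sum_i \sum_k V x 0 k * (dz k (fun y => G y i j) x * invmx (G x) j i)).
  apply: eq_bigr => j _; rewrite mxE; apply: eq_bigr => i _.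
  by rewrite mxE mulr_sumr; apply: eq_bigr => k _; rewrite mulrC -mulrA.
rewrite exchange_big [RHS](eq_bigr (fun k => \sum_i \sum_j
    V x 0 k * (dz k (fun y => G y i j) x * invmx (G x) j i))).
  rewrite [RHS]exchange_big; apply: eq_bigr => i _; exact: exchange_big.
by move=> k _; rewrite mulr_sumr; apply: eq_bigr => i _; rewrite mulr_sumr.
Qed.

(** In the trace formula dbar kills V, and what is left are the second
    derivatives of log det G contracted with V. *)
Lemma dzbar_scal l x : U x -> dzbar l (scal G) x = - \sum_k V x 0 k * ric G x k l.
Proof.
move=> Ux; have sL := csmooth_logdet.
have sdL k : csmooth_on U (dz k (logdet G)) by apply: csmooth_dz.
have sdV : csmooth_on U (fun y => \sum_i dz i (fun z => V z 0 i) y).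
  by apply: csmooth_sum => // i; apply: csmooth_dz.
have sVL k : csmooth_on U (fun y => V y 0 k * dz k (logdet G) y) by apply: csmoothM.
rewrite (dzbar_eq _ oU Ux scal_soliton).
rewrite (dzbarD Ux _ (csmoothD oU (csmooth_cst U _) sdV) (csmooth_sum _ oU sVL)).
rewrite (dzbarD Ux _ (csmooth_cst U _) sdV) dzbar_cst add0r.
rewrite (dzbar_sum oU Ux _ _ (fun i => csmooth_dz i oU (sV i))).
rewrite (dzbar_sum oU Ux _ _ sVL) big1 ?add0r => [|i _].
  rewrite -sumrN; apply: eq_bigr => k _.
  rewrite (dzbarM Ux _ (sV k) (sdL k)) holV// mul0r add0r mxE mulrN opprK.
  by rewrite (dz_dzbar_comm oU Ux).
rewrite -(dz_dzbar_comm oU Ux _ _ (sV i)) -(dz_cst 0 i x).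
by apply: dz_eq oU Ux _ => y Uy; apply: holV.
Qed.

Definition sqnorm (y : E) : C := \sum_k V y 0 k * (flat k y)^*.

Lemma csmooth_sqnorm : csmooth_on U sqnorm.
Proof.
by apply: csmooth_sum => // k; apply: csmoothM => //; apply: csmoothJ => //; apply: csmooth_flat.
Qed.

(** V is holomorphic, so only the conjugate of flat is differentiated, which
    gives the conjugate of Ric - G by the soliton equation. *)
Lemma dzbar_sqnorm l x : U x ->
  dzbar l sqnorm x = \sum_k V x 0 k * (ric G x k l - G x k l).
Proof.
move=> Ux; have sF k : csmooth_on U (fun y => (flat k y)^*).
  by apply: csmoothJ => //; apply: csmooth_flat.
rewrite /sqnorm (dzbar_sum oU Ux); last by move=> k; apply: csmoothM.
apply: eq_bigr => k _; rewrite (dzbarM Ux _ (sV k) (sF k)) holV// mul0r add0r.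
congr (_ * _); rewrite (dzbarJ Ux _ (csmooth_flat k)).
by rewrite -(ric_herm k l Ux) -(GH k l Ux) -rmorphB (soliton l k Ux) addrAC subrr add0r.
Qed.

(** - (scal G + sqnorm) is a potential of V: the contributions of the Ricci
    matrix to the two derivatives cancel. *)
Lemma soliton_potential l x : U x ->
  dzbar l (scal G) x + dzbar l sqnorm x = - flat l x.
Proof.
move=> Ux; rewrite dzbar_scal// dzbar_sqnorm//.
under [X in _ + X]eq_bigr do rewrite mulrBr.
by rewrite sumrB addKr.
Qed.

Section Extremal.
Variable W : E -> 'rV[C]_n.
Hypothesis sW : forall k, csmooth_on U (fun y => W y 0 k).
Hypothesis holW : forall i k x, U x -> dzbar i (fun y => W y 0 k) x = 0.
Hypothesis gradW : forall l x, U x -> \sum_k W x 0 k * G x k l = dzbar l sqnorm x.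

(** <V, W>; as W is the gradient of the squared norm of V, this is also the
    derivative of that norm along V. *)
Definition pairing (y : E) : C := \sum_l flat l y * (W y 0 l)^*.

Lemma csmooth_pairing : csmooth_on U pairing.
Proof.
apply: csmooth_sum => // l; apply: csmoothM => //; first exact: csmooth_flat.
exact: csmoothJ.
Qed.

(** Up to notation the pairing is (Ric - G)(V, conj V), and Ric - G is
    Hermitian. *)
Lemma pairing_real x : U x -> (pairing x)^* = pairing x.
Proof.
move=> Ux; pose H k m := ric G x k m - G x k m.
have HH k m : (H m k)^* = H k m by rewrite rmorphB /= ric_herm// GH.
have pE : pairing x = \sum_k \sum_m V x 0 k * (V x 0 m)^* * H k m.
  transitivity (\sum_k V x 0 k * (dzbar k sqnorm x)^*).
    rewrite /pairing /flat.
    under eq_bigr do rewrite mulr_suml.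
    rewrite exchange_big; apply: eq_bigr => k _ /=.
    rewrite -gradW// rmorph_sum mulr_sumr; apply: eq_bigr => l _.
    by rewrite /= rmorphM /= GH// -mulrA (mulrC (G x k l)).
  apply: eq_bigr => k _; rewrite dzbar_sqnorm// rmorph_sum mulr_sumr.
  by apply: eq_bigr => m _; rewrite /= rmorphM /= HH mulrA.
rewrite pE rmorph_sum exchange_big; apply: eq_bigr => k _; rewrite rmorph_sum /=.
apply: eq_bigr => m _; rewrite rmorphM rmorphM /= HH; congr (_ * _).
by rewrite mulrC; congr (_ * _); exact: conjcK.
Qed.

(** Since W is holomorphic, d_i differentiates only the factor flat of the
    pairing and produces (Ric - G)_i; contracted with V this is dbar of the
    squared norm, the dual of W. *)
Lemma soliton_derive_pairing x : U x ->
  \sum_i V x 0 i * dz i pairing x = \sum_k \sum_l W x 0 k * G x k l * (W x 0 l)^*.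
Proof.
move=> Ux; have sF := csmooth_flat.
have sJ l : csmooth_on U (fun y => (W y 0 l)^*) by apply: csmoothJ.
transitivity (\sum_l dzbar l sqnorm x * (W x 0 l)^*).
  under [RHS]eq_bigr do rewrite dzbar_sqnorm// mulr_suml.
  rewrite exchange_big; apply: eq_bigr => i _ /=.
  rewrite /pairing (dz_sum oU Ux); last by move=> l; apply: csmoothM.
  rewrite mulr_sumr; apply: eq_bigr => l _.
  have dW0 : dz i (fun y => (W y 0 l)^*) x = 0.
    by rewrite (dzJ Ux _ (sW l)) holW//; exact: conjc0.
  rewrite (dzM Ux _ (sF l) (sJ l)) dW0 mulr0 addr0.
  by rewrite soliton// addrAC subrr add0r mulrA.
under eq_bigr do rewrite -gradW// mulr_suml.
exact: exchange_big.
Qed.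

End Extremal.
End Soliton.
End LocalKaehler.

(** * Behaviour under holomorphic maps *)

Section Congruence.
Context (F : fieldType) (n : nat).
Implicit Types J A B K : 'M[F]_n.

Lemma invmx_mul3 J A K : J \in unitmx -> A \in unitmx -> K \in unitmx ->
  invmx (J *m A *m K) = invmx K *m invmx A *m invmx J.
Proof.
move=> Ju Au Ku; have u : J *m A *m K \in unitmx by rewrite !unitmx_mul Ju Au.
apply: (can_inj (mulKmx u)); rewrite mulmxV// !mulmxA mulmxK// mulmxK//.
by rewrite mulmxV.
Qed.

Lemma trace_invmx_congr J A B K : J \in unitmx -> A \in unitmx -> K \in unitmx ->
  \tr (invmx (J *m A *m K) *m (J *m B *m K)) = \tr (invmx A *m B).
Proof.
move=> Ju Au Ku; rewrite invmx_mul3// !mulmxA mulmxKV//.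
by rewrite mxtrace_mulC !mulmxA mulmxV// mul1mx.
Qed.

Lemma row_invmx_congr J A K (r : 'rV[F]_n) : J \in unitmx -> A \in unitmx -> K \in unitmx ->
  r *m K *m invmx (J *m A *m K) *m J = r *m invmx A.
Proof. by move=> Ju Au Ku; rewrite invmx_mul3// !mulmxA mulmxK// mulmxKV. Qed.

End Congruence.

Section Transformation.
Context (R : realType) (n : nat).
Local Notation E := (cspace R n).
Local Notation C := R[i].

Lemma zc_inj (v w : E) : (forall k, zc k v = zc k w) -> v = w.
Proof.
move=> vw; apply: cspace_eq; apply/rowP => k.
  by have [] := vw k.
by have [] := vw k.
Qed.

Lemma zc_mulJ k (v : E) : zc k (mulJ v) = iC R * zc k v.
Proof.
by apply: complexP; rewrite /= ?mxE ?(mul0r, mul1r, sub0r, add0r).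
Qed.

Lemma zc_ex k i : zc k (ex R i : E) = (k == i)%:R.
Proof.
by apply: complexP; rewrite /= !mxE ?eqxx /=; case: (k == i).
Qed.

Definition bar_mx m p (M : 'M[C]_(m, p)) : 'M[C]_(m, p) := map_mx conjc M.

(** A map D that is given by the complex matrix J commutes with the complex
    structures, so pulling back b pulls back its Hermitian form. *)
Lemma herm_mx_pullback (b b' : E -> E -> R) (D : E -> E) (J : 'M[C]_n) :
  (forall (c : R) v v' w, b (c *: v + v') w = c * b v w + b v' w) ->
  (forall v w, b v w = b w v) -> (forall v w, b (mulJ v) (mulJ w) = b v w) ->
  (forall (c : R) v v' w, b' (c *: v + v') w = c * b' v w + b' v' w) ->
  (forall v w, b' v w = b' w v) -> (forall v w, b' (mulJ v) (mulJ w) = b' v w) ->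
  (forall v k, zc k (D v) = \sum_i zc i v * J k i) ->
  (forall v w, b v w = b' (D v) (D w)) ->
  herm_mx b = J^T *m herm_mx b' *m bar_mx J.
Proof.
move=> bl bs bJ bl' bs' bJ' zD bD.
have DJ v : D (mulJ v) = mulJ (D v).
  apply: zc_inj => k; rewrite zc_mulJ !zD mulr_sumr; apply: eq_bigr => i _.
  by rewrite zc_mulJ mulrA.
have zDex i k : zc k (D (ex R i)) = J k i.
  rewrite zD (bigD1 i)//= zc_ex eqxx mul1r big1 ?addr0// => j ji.
  by rewrite zc_ex (negPf ji) mul0r.
have hD v w : hform b v w = hform b' (D v) (D w) by rewrite /hform !bD DJ.
apply/matrixP => i j; have two : (2 : C) != 0 by rewrite pnatr_eq0.
apply: (mulfI two); rewrite -(hform_ex bl bJ) hD (hform_mx bl' bs' bJ'); congr (_ * _).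
rewrite exchange_big mxE; apply: eq_bigr => c _ /=.
rewrite !mxE mulr_suml; apply: eq_bigr => a _; rewrite !mxE !zDex.
by rewrite mulrAC.
Qed.

Definition inner (G : 'M[C]_n) (v w : 'rV[C]_n) : C :=
  \sum_k \sum_l v 0 k * G k l * (w 0 l)^*.

Lemma innerE G v w : inner G v w = (v *m G *m (bar_mx w)^T) 0 0.
Proof.
rewrite /inner exchange_big mxE; apply: eq_bigr => l _ /=.
by rewrite !mxE mulr_suml; apply: eq_bigr => k _.
Qed.

Lemma inner0l (G : 'M[C]_n) (v : 'rV[C]_n) : inner G 0 v = 0.
Proof. by rewrite innerE !mul0mx mxE. Qed.

Lemma inner0r (G : 'M[C]_n) (v : 'rV[C]_n) : inner G v 0 = 0.
Proof. by rewrite innerE /bar_mx map_mx0 trmx0 mulmx0 mxE. Qed.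

Lemma inner_pullback (G G' J : 'M[C]_n) v w :
  G = J^T *m G' *m bar_mx J -> inner G v w = inner G' (v *m J^T) (w *m J^T).
Proof.
move=> ->; rewrite !innerE /bar_mx map_mxM trmx_mul -map_trmx trmxK.
by rewrite !mulmxA.
Qed.

Section Pullback.
Variables (U U' : set E) (psi : E -> E) (G G' : E -> 'M[C]_n).
Hypotheses (oU : open U) (oU' : open U') (UU' : forall x, U x -> U' (psi x)).
Hypothesis psiS : forall k, csmooth_on U (fun y => zc k (psi y)).
Hypothesis psiH : forall i k x, U x -> dzbar i (fun y => zc k (psi y)) x = 0.
Hypothesis Gdet : forall x, U x -> 0 < \det (G x).
Hypothesis sG' : forall i j, csmooth_on U' (fun y => G' y i j).
Hypothesis Gdet' : forall x, U' x -> 0 < \det (G' x).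

Definition jac (psi : E -> E) (x : E) : 'M[C]_n :=
  \matrix_(k, i) dz i (fun y => zc k (psi y)) x.

Hypothesis GT : forall x, U x -> G x = (jac psi x)^T *m G' (psi x) *m bar_mx (jac psi x).

Lemma dz_pullback f i x : U x -> csmooth_on U' f ->
  dz i (fun y => f (psi y)) x = \sum_a jac psi x a i * dz a f (psi x).
Proof.
move=> Ux sf; rewrite (dz_comp oU oU' UU' psiS _ Ux sf); apply: eq_bigr => a _.
by rewrite mxE psiH//; apply: etrans (addr0 _); congr (_ + _); rewrite [X in X * _]conjc0 mul0r.
Qed.

Lemma dzbar_pullback f i x : U x -> csmooth_on U' f ->
  dzbar i (fun y => f (psi y)) x = \sum_a (jac psi x a i)^* * dzbar a f (psi x).
Proof.
move=> Ux sf; rewrite (dzbar_comp oU oU' UU' psiS _ Ux sf); apply: eq_bigr => a _.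
by rewrite mxE psiH// mul0r add0r.
Qed.

Lemma csmooth_jac a i : csmooth_on U (fun y => jac psi y a i).
Proof.
apply: (@csmooth_eq _ _ _ (dz i (fun y => zc a (psi y)))) => //.
  by move=> x _; rewrite mxE.
exact: csmooth_dz.
Qed.

Lemma hol_jac k a i x : U x -> dzbar k (fun y => jac psi y a i) x = 0.
Proof.
move=> Ux; transitivity (dzbar k (dz i (fun y => zc a (psi y))) x).
  by apply: dzbar_eq oU Ux _ => y _; rewrite mxE.
rewrite -(dz_dzbar_comm oU Ux _ _ (psiS a)); apply: etrans (dz_cst 0 i x).
by apply: dz_eq oU Ux _ => y Uy; apply: psiH.
Qed.

Let h (y : E) : C := \det (jac psi y).

Let sh : csmooth_on U h.
Proof. by apply: csmooth_det => // i j; apply: csmooth_jac. Qed.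

Let detG x : U x -> \det (G x) = \det (G' (psi x)) * (h x * (h x)^*).
Proof.
move=> Ux; rewrite GT// !det_mulmx det_tr /bar_mx det_map_mx /=.
by rewrite mulrAC mulrC.
Qed.

(** psi is a local biholomorphism because the pulled back metric is
    nondegenerate. *)
Lemma jac_det_neq0 x : U x -> h x != 0.
Proof.
move=> Ux; apply/eqP => h0; have := Gdet Ux.
by rewrite detG// h0 mul0r mulr0 ltxx.
Qed.

Lemma jac_unit x : U x -> jac psi x \in unitmx.
Proof. by move=> Ux; rewrite unitmxE unitfE; apply: jac_det_neq0. Qed.

Let hol_h k x : U x -> dzbar k h x = 0.
Proof.
move=> Ux; have -> : h = fun y => (\det (bar_mx (jac psi y)))^*.
  by apply/funext => y; rewrite /bar_mx det_map_mx; exact: esym (conjcK _).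
have sJc a i : csmooth_on U (fun y => bar_mx (jac psi y) a i).
  by apply: csmooth_eq (csmoothJ oU (csmooth_jac a i)) => // y _; rewrite [RHS]mxE.
rewrite (dzbarJ Ux _ (csmooth_det oU sJc)) (dz_det oU _ Ux sJc).
rewrite big1; first exact: conjc0.
move=> i _; rewrite big1// => j _.
have -> : dz k (fun y => bar_mx (jac psi y) i j) x = 0; last by rewrite mul0r.
transitivity (dz k (fun y => (jac psi y i j)^*) x).
  by apply: dz_eq oU Ux _ => y _; rewrite [LHS]mxE.
by rewrite (dzJ Ux _ (csmooth_jac i j)) hol_jac//; exact: conjc0.
Qed.

Let h2 (y : E) : R := complex.Re (h y * (h y)^*).

Let h2E y : (h2 y)%:C = h y * (h y)^*.
Proof. by rewrite /h2; case: (h y) => a b; apply: complexP => //=; ring. Qed.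

Let h2_gt0 y : U y -> 0 < h2 y.
Proof.
move=> Uy; rewrite -ltcR h2E lt_neqAle mulcJ_ge0 andbT eq_sym mulf_neq0//.
  exact: jac_det_neq0.
by rewrite conjc_eq0 jac_det_neq0.
Qed.

Let sh2 : smooth_on U h2.
Proof. exact: (csmoothM oU sh (csmoothJ oU sh)).1. Qed.

Let logdetT y : U y -> logdet G y = logdet G' (psi y) + (ln (h2 y))%:C.
Proof.
move=> Uy; rewrite /logdet detG// -rmorphD /=; congr (_%:C).
have [dE d0] := gt0_complex (Gdet' (UU' Uy)).
have Rm (a c : R) : complex.Re (a%:C * c%:C) = a * c by rewrite /= mulr0 subr0.
by rewrite {1}dE -h2E Rm lnM// posrE h2_gt0.
Qed.

Let q j y := dz j h y * (h y)^-1.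

Let sq j : csmooth_on U (q j).
Proof.
apply: csmoothM => //; first exact: csmooth_dz.
by apply: csmoothV => //; exact: jac_det_neq0.
Qed.

Let hol_q i j x : U x -> dzbar i (q j) x = 0.
Proof.
move=> Ux; have shV : csmooth_on U (fun y => (h y)^-1).
  by apply: csmoothV => //; exact: jac_det_neq0.
have hV : dzbar i (fun y => (h y)^-1) x = 0.
  have : dzbar i (fun y => h y * (h y)^-1) x = 0.
    apply: etrans (dzbar_cst 1 i x); apply: dzbar_eq oU Ux _ => y Uy.
    by rewrite mulfV// jac_det_neq0.
  rewrite (dzbarM Ux _ sh shV) hol_h// mul0r add0r => /eqP.
  by rewrite mulf_eq0 (negPf (jac_det_neq0 Ux)) => /eqP.
rewrite (dzbarM Ux _ (csmooth_dz j oU sh) shV) hV mulr0 addr0.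
rewrite -(dz_dzbar_comm oU Ux _ _ sh).
suff -> : dz j (dzbar i h) x = 0 by rewrite mul0r.
apply: etrans (dz_cst 0 j x).
by apply: dz_eq oU Ux _ => y Uy; apply: hol_h.
Qed.

Let dzbar_ln_h2 j y : U y -> dzbar j (fun y => (ln (h2 y))%:C) y = (q j y)^*.
Proof.
move=> Uy; rewrite (dzbar_ln _ Uy h2_gt0 sh2).
have -> : dzbar j (fun y => (h2 y)%:C) y = dzbar j (fun y => h y * (h y)^*) y.
  by congr (dzbar j _ y); apply/funext => z; apply: h2E.
rewrite (dzbarM Uy _ sh (csmoothJ oU sh)) hol_h// mul0r add0r (dzbarJ Uy _ sh) h2E.
rewrite -mulf_div mulfV ?jac_det_neq0// mul1r.
by rewrite /q [RHS]rmorphM /= fmorphV.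
Qed.

(** The logarithms of the two determinants differ by log |h|^2, where the
    Jacobian determinant h is holomorphic.  Its dbar is the conjugate of the
    holomorphic function d h / h, which d kills; in the other term d does
    not see the conjugate Jacobian. *)
Lemma ric_pullback x : U x ->
  ric G x = (jac psi x)^T *m ric G' (psi x) *m bar_mx (jac psi x).
Proof.
move=> Ux; have sL' := csmooth_logdet oU' sG' Gdet'.
have sL'psi := csmooth_comp oU oU' UU' psiS sL'.
have sln : csmooth_on U (fun y => (ln (h2 y))%:C).
  by apply: csmooth_real => m; apply: Ck_on_ln => //; apply: sh2.
have sbL b := csmooth_comp oU oU' UU' psiS (csmooth_dzbar b oU' sL').
have sJJ b j := csmoothJ oU (csmooth_jac b j).
have sT j b : csmooth_on U (fun z => (jac psi z b j)^* * dzbar b (logdet G') (psi z)).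
  by apply: csmoothM.
have E1 j y : U y -> dzbar j (logdet G) y =
    \sum_b (jac psi y b j)^* * dzbar b (logdet G') (psi y) + (q j y)^*.
  move=> Uy; rewrite (dzbar_eq _ oU Uy logdetT) (dzbarD Uy _ sL'psi sln).
  by rewrite dzbar_ln_h2// dzbar_pullback.
apply/matrixP => i j; rewrite mxE (dz_eq _ oU Ux (E1 j)).
rewrite (dzD Ux _ (csmooth_sum _ oU (sT j)) (csmoothJ oU (sq j))).
have -> : dz i (fun y => (q j y)^*) x = 0.
  by rewrite (dzJ Ux _ (sq j)) hol_q//; exact: conjc0.
rewrite addr0 (dz_sum oU Ux _ _ (sT j)) -sumrN mxE; apply: eq_bigr => b _.
rewrite (dzM Ux _ (sJJ b j) (sbL b)).
have -> : dz i (fun y => (jac psi y b j)^*) x = 0.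
  by rewrite (dzJ Ux _ (csmooth_jac b j)) hol_jac//; exact: conjc0.
rewrite mul0r add0r (dz_pullback _ Ux (csmooth_dzbar b oU' sL')) mulrC -mulNr.
rewrite -sumrN; congr (_ * _); last by rewrite [RHS]mxE.
by rewrite mxE; apply: eq_bigr => a _; rewrite !mxE mulrN.
Qed.

Lemma scal_pullback x : U x -> scal G x = scal G' (psi x).
Proof.
move=> Ux; have Ju := jac_unit Ux.
rewrite /scal (ric_pullback Ux) (GT Ux).
apply: trace_invmx_congr; first by rewrite unitmx_tr.
  by apply: (posdet_unit (U := U') (G := G')) => //; apply: UU'.
by rewrite /bar_mx map_unitmx.
Qed.

Definition grad (G : E -> 'M[C]_n) (u : E -> C) (x : E) : 'rV[C]_n :=
  (\row_j dzbar j u x) *m invmx (G x).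

Lemma grad_pullback u u' x : (forall y, U y -> u y = u' (psi y)) ->
  csmooth_on U' u' -> U x -> grad G u x *m (jac psi x)^T = grad G' u' (psi x).
Proof.
move=> uu' su' Ux.
have Ju := jac_unit Ux.
have rowE : \row_j dzbar j u x = (\row_b dzbar b u' (psi x)) *m bar_mx (jac psi x).
  apply/rowP => j; rewrite !mxE (dzbar_eq _ oU Ux uu') dzbar_pullback//.
  by apply: eq_bigr => b _; rewrite !mxE mulrC.
rewrite /grad rowE (GT Ux).
apply: row_invmx_congr; first by rewrite unitmx_tr.
  by apply: (posdet_unit (U := U') (G := G')) => //; apply: UU'.
by rewrite /bar_mx map_unitmx.
Qed.

End Pullback.
End Transformation.

(** * Forms of type (1,1) *)

Section FormAlgebra.
Context (F : comNzRingType).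
Implicit Types c h p x y : F.

Lemma skew_scale c h p x y :
  (c * x + - c * y) * h * p = c * p * ((x - y) * h).
Proof. by ring. Qed.

Lemma delta_scale N d d' s t : N * (d * s * (d' * t)) = s * t * (N * (d * d')) :> F.
Proof. by ring. Qed.

Lemma lie_alg a b c d : a * b * (c * d) = b * c * (a * d) :> F.
Proof. by ring. Qed.

Lemma closed_alg s s' r r' q q'
    mkl mlk klm kml lmk lkm mkl' mlk' klm' kml' lmk' lkm' :
  s * r * q' * (mkl - kml) + s * q * r' * (- mlk + lmk) + r * q * s' * (klm - lkm)
  + s' * r' * q * (- mlk' + klm') + s' * q' * r * (mkl' - lkm')
  + r' * q' * s * (- kml' + lmk') =
  s * (r * q' * mkl - q * r' * mlk) + s' * (r * q' * mkl' - q * r' * mlk')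
  + (r * (q * s' * klm - s * q' * kml) + r' * (q * s' * klm' - s * q' * kml'))
  + (q * (s * r' * lmk - r * s' * lkm) + q' * (s * r' * lmk' - r * s' * lkm')) :> F.
Proof. by ring. Qed.

End FormAlgebra.

Section WedgeAlgebra.
Context (F : numFieldType) (I : F).
Hypothesis II : I * I = -1.

Lemma wedge_alg (d e z z' : F) :
  (d * z' - z * e - I * (d * I * z' - z * (e * - I))) / 2 = d * z'.
Proof.
transitivity ((d * z' - z * e - (I * I) * (d * z' + z * e)) / 2); first by field.
by rewrite II; field.
Qed.

End WedgeAlgebra.

Section TypeOneOne.
Context (R : realType) (n : nat).
Local Notation E := (cspace R n).
Local Notation C := R[i].

(** The value of dz_k /\ dzbar_l on (v, w). *)
Definition wedge11 (k l : 'I_n) (v w : E) : C :=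
  zc k v * (zc l w)^* - zc k w * (zc l v)^*.

(** The Kaehler form is a multiple of the imaginary part of the Hermitian
    form. *)
Lemma form_kahler (b : E -> E -> R) v w :
  (forall (c : R) v v' w, b (c *: v + v') w = c * b v w + b v' w) ->
  (forall v w, b v w = b w v) -> (forall v w, b (mulJ v) (mulJ w) = b v w) ->
  (b (mulJ v) w / (2 * pi))%:C =
  iC R / (2 * pi)%:C * \sum_k \sum_l herm_mx b k l * wedge11 k l v w.
Proof.
move=> bl bs bJ.
have -> : \sum_k \sum_l herm_mx b k l * wedge11 k l v w = (hform b v w - hform b w v) / 2.
  rewrite !(hform_mx bl bs bJ) -mulrBr mulrC mulKf ?pnatr_eq0// -sumrB.
  apply: eq_bigr => k _; rewrite -sumrB; apply: eq_bigr => l _.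
  by rewrite mulrC mulrBl.
rewrite rmorphM /= fmorphV (b_hform b) (hform_mulJl bl bJ) rmorphM /= iCJ (hformJ bl bs bJ).
exact: skew_scale.
Qed.

(** u is s times the k-th complex coordinate direction, for s = 1 or s = i,
    and s' is the conjugate of s.  Treating both real directions at once
    allows types to be separated by how an expression depends on s. *)
Definition coord_dir (k : 'I_n) (u : E) (s s' : C) : Prop :=
  [/\ u = ex R k, s = 1 & s' = 1] \/ [/\ u = ey R k, s = iC R & s' = - iC R].

Lemma zc_ey k i : zc k (ey R i : E) = (k == i)%:R * iC R.
Proof. by rewrite -mulJ_ex zc_mulJ zc_ex mulrC. Qed.

Lemma zc_dir k i u s s' : coord_dir i u s s' -> zc k u = (k == i)%:R * s.
Proof. by case=> [] [-> -> _]; rewrite ?zc_ey// zc_ex mulr1. Qed.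

Lemma zcJ_dir k i u s s' : coord_dir i u s s' -> (zc k u)^* = (k == i)%:R * s'.
Proof.
move=> H; rewrite (zc_dir k H) rmorphM /= rmorph_nat; congr (_ * _).
by case: H => [] [_ -> ->]; rewrite ?iCJ//; exact: conjc1.
Qed.

Lemma cD_dir k u s s' f x : coord_dir k u s s' ->
  cD u f x = s * dz k f x + s' * dzbar k f x.
Proof.
case=> [] [-> -> ->]; first by rewrite cD_ex !mul1r.
by rewrite cD_ey mulrBr mulNr.
Qed.

Lemma sum2_delta (N : 'I_n -> 'I_n -> C) i j :
  \sum_k \sum_l N k l * ((k == i)%:R * (l == j)%:R) = N i j.
Proof.
rewrite (bigD1 i)//= [X in _ + X]big1 ?addr0 => [|k ki]; last first.
  by rewrite big1// => l _; rewrite (negPf ki) mul0r mulr0.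
rewrite (bigD1 j)//= big1 ?addr0 => [|l lj]; last by rewrite (negPf lj) mulr0 mulr0.
by rewrite !eqxx !mulr1.
Qed.

Lemma sum_wedge11_dir (N : 'I_n -> 'I_n -> C) i j v s s' w t t' :
  coord_dir i v s s' -> coord_dir j w t t' ->
  \sum_k \sum_l N k l * wedge11 k l v w = s * t' * N i j - t * s' * N j i.
Proof.
move=> Hv Hw; rewrite -{1}(sum2_delta N i j) -(sum2_delta N j i) !mulr_sumr -sumrB.
apply: eq_bigr => k _; rewrite !mulr_sumr -sumrB; apply: eq_bigr => l _.
rewrite /wedge11 (zc_dir k Hv) (zcJ_dir l Hw) (zc_dir k Hw) (zcJ_dir l Hv).
rewrite mulrBr; congr (_ - _).
  exact: delta_scale.
exact: delta_scale.
Qed.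

(** On the directions ex i, ex j and ex i, ey j the form gives N i j - N j i
    and, up to the factor -i, N i j + N j i. *)
Lemma wedge11_inj (N : 'I_n -> 'I_n -> C) :
  (forall v w, \sum_k \sum_l N k l * wedge11 k l v w = 0) -> forall i j, N i j = 0.
Proof.
move=> H i j.
have Hx k : coord_dir k (ex R k) 1 1 by left.
have Hy k : coord_dir k (ey R k) (iC R) (- iC R) by right.
have := H (ex R i) (ex R j); rewrite (sum_wedge11_dir _ (Hx i) (Hx j)) !mulr1 !mul1r => /eqP.
rewrite subr_eq0 => /eqP E1.
have := H (ex R i) (ey R j); rewrite (sum_wedge11_dir _ (Hx i) (Hy j)) mul1r mulr1 -E1.
rewrite mulNr -opprD => /eqP; rewrite oppr_eq0 -mulrDr -mulr2n.
rewrite mulf_eq0 mulrn_eq0 /= => /orP[/eqP i0|/eqP//].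
by have := iC2 R; rewrite i0 mulr0 => /eqP; rewrite eq_sym oppr_eq0 oner_eq0.
Qed.

End TypeOneOne.

Section ExtractTwoOne.
Context (F : numFieldType) (I : F).
Hypothesis II : I * I = -1.

(** The six terms are the parts of types (2,1) and (1,2) of a 3-form, evaluated
    on s, t, r times three coordinate directions.  Letting s, t, r be 1 or I
    separates them. *)
Lemma type21_part (a1 a2 a3 a4 a5 a6 : F) :
  (forall s s' t t' r r' : F,
    (s = 1 /\ s' = 1 \/ s = I /\ s' = - I) ->
    (t = 1 /\ t' = 1 \/ t = I /\ t' = - I) ->
    (r = 1 /\ r' = 1 \/ r = I /\ r' = - I) ->
    s * t * r' * a1 + s * r * t' * a2 + t * r * s' * a3 +
    s' * t' * r * a4 + s' * r' * t * a5 + t' * r' * s * a6 = 0) ->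
  a1 = 0.
Proof.
move=> H.
have o : (1 : F) = 1 /\ (1 : F) = 1 \/ (1 : F) = I /\ (1 : F) = - I by left.
have i : I = 1 /\ - I = 1 \/ I = I /\ - I = - I by right.
have I0 : I != 0.
  by apply/eqP => I0; move: II; rewrite I0 mul0r => /eqP; rewrite eq_sym oppr_eq0 oner_eq0.
have red x : I * x = 0 -> x = 0 by move=> /eqP; rewrite mulf_eq0 (negPf I0) => /eqP.
have f1 : a1 + a2 + a3 + a4 + a5 + a6 = 0.
  by rewrite -(H _ _ _ _ _ _ o o o); ring.
have f2 : - a1 + a2 + a3 - a4 + a5 + a6 = 0.
  transitivity ((I * I) * a1 - (I * I) * a2 - (I * I) * a3 + (I * I) * a4
    - (I * I) * a5 - (I * I) * a6); first by rewrite II; ring.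
  by rewrite -(H _ _ _ _ _ _ i i o); ring.
have f3 : a1 + a2 - a3 - a4 - a5 + a6 = 0.
  by apply: red; rewrite -(H _ _ _ _ _ _ i o o); ring.
have f4 : a1 - a2 + a3 - a4 + a5 - a6 = 0.
  by apply: red; rewrite -(H _ _ _ _ _ _ o i o); ring.
(* The difference of f1 and f2 is 2 (a1 + a4), the sum of f3 and f4 is
   2 (a1 - a4). *)
have : 4 * a1 = 0.
  transitivity ((a1 + a2 + a3 + a4 + a5 + a6) - (- a1 + a2 + a3 - a4 + a5 + a6)
    + (a1 + a2 - a3 - a4 - a5 + a6) + (a1 - a2 + a3 - a4 + a5 - a6)); first by ring.
  by rewrite f1 f2 f3 f4 subrr !addr0.
by move=> /eqP; rewrite mulf_eq0 pnatr_eq0 => /eqP.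
Qed.

End ExtractTwoOne.

Section LocalForms.
Context (R : realType) (n : nat).
Local Notation E := (cspace R n).
Local Notation C := R[i].
Variables (U : set E) (oU : open U) (G : E -> 'M[C]_n).
Hypothesis sG : forall i j, csmooth_on U (fun y => G y i j).
Variables (t : E -> E -> E -> C) (c0 : C).
Hypothesis c0_neq0 : c0 != 0.
Hypothesis tE : forall y v w, U y ->
  t y v w = c0 * \sum_k \sum_l G y k l * wedge11 k l v w.

Lemma cD_form_dir x m u s s' k v r r' l w q q' : U x ->
  coord_dir m u s s' -> coord_dir k v r r' -> coord_dir l w q q' ->
  cD u (fun y => t y v w) x =
  c0 * (s * (r * q' * dz m (fun y => G y k l) x - q * r' * dz m (fun y => G y l k) x)
   + s' * (r * q' * dzbar m (fun y => G y k l) x - q * r' * dzbar m (fun y => G y l k) x)).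
Proof.
move=> Ux Hu Hv Hw.
have sZ c i j : csmooth_on U (fun y => c * G y i j).
  by apply: csmoothM => //; exact: csmooth_cst.
have smooth_Nrm c i j : csmooth_on U (fun y => - (c * G y i j)) by apply: csmoothN.
rewrite (@cD_eq _ _ U _ (fun y => c0 * (r * q' * G y k l + - (q * r' * G y l k))) _ _ oU Ux); last first.
  by move=> y Uy; rewrite tE// (sum_wedge11_dir _ Hv Hw).
have sS := csmoothD oU (sZ (r * q') k l) (smooth_Nrm (q * r') l k).
rewrite (cDZ Ux _ _ sS); congr (_ * _); rewrite (cD_dir _ _ Hu).
rewrite (dzD Ux _ (sZ _ _ _) (smooth_Nrm _ _ _)) (dzbarD Ux _ (sZ _ _ _) (smooth_Nrm _ _ _)).
rewrite (dzN Ux _ (sZ _ _ _)) (dzbarN Ux _ (sZ _ _ _)).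
by rewrite !(dzZ Ux _ _ (sG _ _)) !(dzbarZ Ux _ _ (sG _ _)).
Qed.

(** The part of type (2,1) of the exterior derivative of a form of type (1,1)
    has the coefficients d_m G_(k lbar) - d_k G_(m lbar). *)
Lemma closed_form_kahler :
  (forall x u v w, U x -> cD u (fun y => t y v w) x + cD v (fun y => t y w u) x
      + cD w (fun y => t y u v) x = 0) ->
  forall x k l m, U x -> dz m (fun y => G y k l) x = dz k (fun y => G y m l) x.
Proof.
move=> closed x k l m Ux.
have dir (i : 'I_n) (s s' : C) : (s = 1 /\ s' = 1 \/ s = iC R /\ s' = - iC R) ->
    exists u, coord_dir i u s s'.
  by case=> -[-> ->]; [exists (ex R i); left | exists (ey R i); right].
apply/eqP; rewrite -subr_eq0; apply/eqP.
apply: (@type21_part _ (iC R) (iC2 R) _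
  (- dz m (fun y => G y l k) x + dz l (fun y => G y m k) x)
  (dz k (fun y => G y l m) x - dz l (fun y => G y k m) x)
  (- dzbar m (fun y => G y l k) x + dzbar k (fun y => G y l m) x)
  (dzbar m (fun y => G y k l) x - dzbar l (fun y => G y k m) x)
  (- dzbar k (fun y => G y m l) x + dzbar l (fun y => G y m k) x)).
move=> s s' r r' q q' /(dir m)[u Hu] /(dir k)[v Hv] /(dir l)[w Hw].
have := closed x u v w Ux.
rewrite (cD_form_dir Ux Hu Hv Hw) (cD_form_dir Ux Hv Hw Hu) (cD_form_dir Ux Hw Hu Hv).
rewrite -!mulrDr => /eqP; rewrite mulf_eq0 (negPf c0_neq0) => /eqP E0.
apply: etrans E0; exact: closed_alg.
Qed.

Lemma wedge11C (k l : 'I_n) (v w : E) : wedge11 k l v w = - wedge11 k l w v :> C.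
Proof. by rewrite /wedge11 opprB. Qed.

Lemma wedge11_dz (i l k : 'I_n) (w : E) :
  (wedge11 i l (ex R k) w - iC R * wedge11 i l (ey R k) w) / 2 =
  (i == k)%:R * (zc l w)^*.
Proof.
have Hx : coord_dir k (ex R k) 1 1 by left.
have Hy : coord_dir k (ey R k) (iC R) (- iC R) by right.
rewrite /wedge11 (zc_dir _ Hx) (zcJ_dir _ Hx) (zc_dir _ Hy) (zcJ_dir _ Hy) !mulr1.
exact: (@wedge_alg (R[i] : numFieldType) (iC R) (iC2 R)).
Qed.

(** The contraction with d/dz_k sees only the factor dz_k. *)
Lemma form_dz x k w : U x ->
  (t x (ex R k) w - iC R * t x (ey R k) w) / 2 = c0 * \sum_l G x k l * (zc l w)^*.
Proof.
move=> Ux; rewrite !tE// mulrCA -mulrBr -mulrA; congr (_ * _).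
rewrite mulr_sumr -sumrB mulr_suml (bigD1 k)//= [X in _ + X]big1 ?addr0.
  rewrite mulr_sumr -sumrB mulr_suml; apply: eq_bigr => l _.
  by rewrite mulrCA -mulrBr -mulrA wedge11_dz eqxx mul1r.
move=> i ik; rewrite mulr_sumr -sumrB mulr_suml big1// => l _.
by rewrite mulrCA -mulrBr -mulrA wedge11_dz (negPf ik) mul0r mulr0.
Qed.

Lemma formC x v w : U x -> t x v w = - t x w v.
Proof.
move=> Ux; rewrite !tE// -mulrN -sumrN; congr (_ * _); apply: eq_bigr => k _.
rewrite -sumrN; apply: eq_bigr => l _; by rewrite wedge11C mulrN.
Qed.

Lemma form_dzr x k v : U x ->
  (t x v (ex R k) - iC R * t x v (ey R k)) / 2 = - (c0 * \sum_l G x k l * (zc l v)^*).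
Proof.
move=> Ux; rewrite (formC v (ex R k) Ux) (formC v (ey R k) Ux) -form_dz//.
by rewrite mulrN -opprD mulNr.
Qed.

Hypothesis GK : forall x i j k, U x ->
  dz k (fun y => G y i j) x = dz i (fun y => G y k j) x.
Variable V : E -> 'rV[C]_n.
Hypothesis sV : forall k, csmooth_on U (fun y => V y 0 k).
Hypothesis holV : forall i k x, U x -> dzbar i (fun y => V y 0 k) x = 0.

(** Cartan's formula in coordinates: the Lie derivative of the closed form is
    the exterior derivative of its contraction with V, that is d of flat.
    The Kaehler condition turns the derivative of G along V into the missing
    part of the derivative of V^k G_(k lbar). *)
Lemma lie_form x v w : U x ->
  \sum_k (V x 0 k * dz k (fun y => t y v w) x
    + cD v (fun y => V y 0 k) x * ((t x (ex R k) w - iC R * t x (ey R k) w) / 2)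
    + cD w (fun y => V y 0 k) x * ((t x v (ex R k) - iC R * t x v (ey R k)) / 2)) =
  c0 * \sum_i \sum_l dz i (flat G V l) x * wedge11 i l v w.
Proof.
move=> Ux.
pose D i k := dz i (fun y => V y 0 k) x.
have cDV u k : cD u (fun y => V y 0 k) x = \sum_i zc i u * D i k.
  rewrite (cD_expand _ oU Ux (sV k)); apply: eq_bigr => i _.
  by rewrite holV// mulr0 addr0.
have dzt k : dz k (fun y => t y v w) x =
    c0 * \sum_i \sum_l dz k (fun y => G y i l) x * wedge11 i l v w.
  have sT i l : csmooth_on U (fun y => G y i l * wedge11 i l v w).
    by apply: csmoothM => //; exact: csmooth_cst.
  have sTT i := csmooth_sum (index_enum _) oU (sT i).
  rewrite (@dz_eq _ _ U _ (fun y => c0 * \sum_i \sum_l G y i l * wedge11 i l v w) _ _ oU Ux); last first.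
    by move=> y Uy; rewrite tE.
  rewrite (dzZ Ux _ _ (csmooth_sum _ oU sTT)) (dz_sum oU Ux _ _ sTT); congr (_ * _).
  apply: eq_bigr => i _; rewrite (dz_sum oU Ux _ _ (sT i)); apply: eq_bigr => l _.
  rewrite (dzM Ux _ (sG i l) (csmooth_cst U _)) dz_cst mulr0 addr0.
  by [].
have dflat i l : dz i (flat G V l) x = \sum_k (D i k * G x k l +
     V x 0 k * dz k (fun y => G y i l) x).
  rewrite /flat (dz_sum oU Ux); last by move=> k; apply: csmoothM.
  by apply: eq_bigr => k _; rewrite (dzM Ux _ (sV k) (sG _ _)) (GK _ _ _ Ux).
have B u z : \sum_k (\sum_i zc i u * D i k) * (c0 * \sum_l G x k l * (zc l z)^*)
   = c0 * \sum_i \sum_l (\sum_k D i k * G x k l) * (zc i u * (zc l z)^*).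
  under eq_bigr do rewrite mulrCA.
  rewrite -mulr_sumr; congr (_ * _).
  under eq_bigr do rewrite mulr_suml.
  rewrite exchange_big; apply: eq_bigr => i _ /=.
  under eq_bigr do rewrite mulr_sumr.
  rewrite exchange_big; apply: eq_bigr => l _ /=; rewrite mulr_suml.
  apply: eq_bigr => k _; exact: lie_alg.
have T : \sum_k V x 0 k * \sum_i \sum_l dz k (fun y => G y i l) x * wedge11 i l v w
   = \sum_i \sum_l (\sum_k V x 0 k * dz k (fun y => G y i l) x) * wedge11 i l v w.
  rewrite (eq_bigr (fun k => \sum_i \sum_l
      V x 0 k * (dz k (fun y => G y i l) x * wedge11 i l v w))); last first.
    by move=> k _; rewrite mulr_sumr; apply: eq_bigr => i _; rewrite mulr_sumr.
  rewrite exchange_big; apply: eq_bigr => i _ /=.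
  rewrite exchange_big; apply: eq_bigr => l _ /=.
  by rewrite mulr_suml; apply: eq_bigr => k _; rewrite mulrA.
rewrite !big_split /=.
under eq_bigr do rewrite dzt.
under [X in _ + X + _]eq_bigr do rewrite cDV form_dz//.
under [X in _ + _ + X]eq_bigr do rewrite cDV form_dzr// mulrN.
rewrite sumrN !B.
under eq_bigr do rewrite mulrCA.
rewrite -mulr_sumr -addrA -mulrBr -mulrDr; congr (_ * _).
rewrite T -sumrB -big_split; apply: eq_bigr => i _ /=.
rewrite -sumrB -big_split; apply: eq_bigr => l _ /=.
by rewrite dflat big_split /= mulrDl -mulrBr addrC.
Qed.

End LocalForms.

(** * Metrics on a complex manifold *)

Section Charts.
Context (R : realType) (n : nat) (X : topologicalType) (A : complex_atlas R n X).
Local Notation E := (cspace R n).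
Local Notation C := R[i].
Local Notation I := (cindex A).
Implicit Types (a b : I) (x y v w : E) (f : X -> X).

Lemma open_cimg a : open (cimg a).
Proof. exact: cimg_open. Qed.

Lemma cimg_inv a x : cimg a x -> cdom a (chart_inv a x) /\ chart a (chart_inv a x) = x.
Proof. by move=> [P Pa <-]; rewrite chartK. Qed.

Lemma open_loc_dom f a b : continuous f -> open (loc_dom f a b).
Proof.
move=> cf; rewrite openE => x [xa xb].
have h1 : nbhs x (cimg a) by apply: open_nbhs_nbhs; split=> //; exact: open_cimg.
have c1 : {for x, continuous (fun y => f (chart_inv a y))}.
  apply: (@continuous_comp _ _ _ (chart_inv a) f); last exact: cf.
  exact: chart_inv_continuous.
have h2 : nbhs x (fun y => cdom b (f (chart_inv a y))).
  by apply: (c1 (cdom b)); apply: open_nbhs_nbhs; split=> //; exact: cdom_open.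
exact: filterI h1 h2.
Qed.

Lemma loc_dom_sub f a b : loc_dom f a b `<=` cimg a.
Proof. by move=> x []. Qed.

Lemma loc_cimg f a b x : loc_dom f a b x -> cimg b (loc f a b x).
Proof. by move=> [_ ?]; exists (f (chart_inv a x)). Qed.

Lemma holomorphic_map_id : holomorphic_map A idfun.
Proof.
split; first by move=> P; exact: cvg_id.
move=> a b; exact: transition_holomorphic.
Qed.

(** F stands for a function on X given in the charts; its maximum is located in
    a chart, where derivatives can be taken. *)
Section GlobalMaximum.
Variable F : I -> E -> R.
Hypothesis F_inv : forall a b x, loc_dom idfun a b x -> F a x = F b (loc idfun a b x).
Hypothesis F_cont : forall a x, cimg a x -> {for x, continuous (F a)}.

Lemma global_max : compact [set: X] -> [set: X] !=set0 ->
  exists a x, cimg a x /\ forall b y, cimg b y -> F b y <= F a x.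
Proof.
move=> cX X0.
pose c P := sval (cid (cdom_cover A P)).
have cP P : cdom (c P) P by rewrite /c; case: cid.
pose Phi P := F (c P) (chart (c P) P).
have PhiE a P : cdom a P -> Phi P = F a (chart a P).
  move=> Pa; have D : loc_dom idfun (c P) a (chart (c P) P).
    by split; [exists P | rewrite /= chartK].
  by rewrite /Phi (F_inv D) /loc /= chartK.
have cPhi : continuous Phi.
  move=> P; set a := c P; have Pa : cdom a P by exact: cP.
  have cFa : {for P, continuous (fun Q => F a (chart a Q))}.
    apply: (@continuous_comp _ _ _ (chart a) (F a)); first exact: chart_continuous.
    by apply: F_cont; exists P.
  rewrite /continuous_at (PhiE _ _ Pa); apply: cvg_trans cFa; apply: near_eq_cvg.
  have : nbhs P (cdom a) by apply: open_nbhs_nbhs; split=> //; exact: cdom_open.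
  by apply: filterS => Q /PhiE ->.
have [P _ Pmax] := compact_EVT_max X0 cX (continuous_subspaceT cPhi).
exists (c P), (chart (c P) P); split; first by exists P.
move=> b y yb; have [yd yE] := cimg_inv yb.
by have := Pmax (chart_inv b y) (in_setT _); rewrite (PhiE _ _ yd) yE.
Qed.

End GlobalMaximum.

Lemma dz_dzbar_at_max (U : set E) (u : E -> R) x k : open U -> U x -> smooth_on U u ->
  (forall y, U y -> u y <= u x) ->
  dz k (fun y => (u y)%:C) x = 0 /\ dzbar k (fun y => (u y)%:C) x = 0.
Proof.
move=> oU Ux su umax.
have H v : cD v (fun y => (u y)%:C) x = 0.
  apply: complexP => /=; last exact: derive_cst.
  exact: derive_at_max oU Ux (su 1%N) umax.
by rewrite /dz /dzbar !H mulr0 subr0 addr0 mul0r.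
Qed.

Lemma scalar_curvatureE (g : metric A) a x :
  scalar_curvature g a x = 2 * scal (g_mx g a) x.
Proof. by []. Qed.

Section HermitianMetric.
Variable g : metric A.
Hypothesis g_herm : Defs.hermitian g.

Lemma metric_lin a x : cimg a x -> forall (c : R) v v' w,
  g a x (c *: v + v') w = c * g a x v w + g a x v' w.
Proof. by case: g_herm => -[+ _ _ _ _] _; apply. Qed.

Lemma metric_sym a x : cimg a x -> forall v w, g a x v w = g a x w v.
Proof. by case: g_herm => -[_ H _ _ _] _ xa v w; apply: H. Qed.

Lemma metric_pos a x : cimg a x -> forall v, v != 0 -> 0 < g a x v v.
Proof. by case: g_herm => -[_ _ H _ _] _ xa v; apply: H. Qed.

Lemma metric_J a x : cimg a x -> forall v w, g a x (mulJ v) (mulJ w) = g a x v w.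
Proof. by case: g_herm => _ H xa v w; apply: H. Qed.

Lemma metric_id : pullback2 idfun g g.
Proof. by case: g_herm => -[]. Qed.

Lemma csmooth_g_mx a i j : csmooth_on (cimg a) (fun y => g_mx g a y i j).
Proof.
have oU := open_cimg (a := a).
have sg v w : smooth_on (cimg a) (fun y => g a y v w) by case: g_herm => -[_ _ _ H _] _.
apply: (@csmooth_eq _ _ _ (fun y =>
  ((g a y (ex R i) (ex R j) + g a y (ey R i) (ey R j))
   +i* (g a y (ex R i) (ey R j) + - g a y (ey R i) (ex R j))) * 4^-1)) => //.
  by move=> y _; rewrite mxE.
apply: csmoothM => //; last exact: csmooth_cst.
by split=> /=; apply: smoothD => //; apply: smoothN.
Qed.

Lemma g_mx_herm a x i j : cimg a x -> (g_mx g a x j i)^* = g_mx g a x i j.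
Proof.
move=> xa; exact: (herm_mx_hermitian (metric_lin xa) (metric_sym xa) (metric_J xa)).
Qed.

Lemma g_mx_posdef a x (u : 'rV[C]_n) : cimg a x -> u != 0 -> 0 < inner (g_mx g a x) u u.
Proof.
move=> xa; exact: (herm_mx_posdef (metric_lin xa) (metric_sym xa) (metric_J xa) (metric_pos xa)).
Qed.

Lemma g_mx_det a x : cimg a x -> 0 < \det (g_mx g a x).
Proof.
move=> xa; exact: (herm_mx_det (metric_lin xa) (metric_sym xa) (metric_J xa) (metric_pos xa)).
Qed.

Lemma g_mx_unit a x : cimg a x -> g_mx g a x \in unitmx.
Proof. by apply: (posdet_unit (U := cimg a)) => y; exact: g_mx_det. Qed.

Lemma kahler_formE a x v w : cimg a x ->
  kahler_form g a x v w =
  iC R / (2 * pi)%:C * \sum_k \sum_l g_mx g a x k l * wedge11 k l v w.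
Proof. by move=> xa; apply: form_kahler; [exact: metric_lin|exact: metric_sym|exact: metric_J]. Qed.

Lemma gradC_flat a x u l : cimg a x ->
  \sum_k gradC g u a x 0 k * g_mx g a x k l = dzbar l (u a) x.
Proof.
move=> xa; transitivity ((gradC g u a x *m g_mx g a x) 0 l); first by rewrite mxE.
by rewrite /gradC mulmxKV ?g_mx_unit// mxE.
Qed.

Lemma csmooth_scal a : csmooth_on (cimg a) (scal (g_mx g a)).
Proof.
have oU := open_cimg (a := a).
have sG i j : csmooth_on (cimg a) (fun y => g_mx g a y i j) by exact: csmooth_g_mx.
have sL : csmooth_on (cimg a) (logdet (g_mx g a)).
  by apply: csmooth_logdet => // x; exact: g_mx_det.
apply: csmooth_sum => // i.
apply: (@csmooth_eq _ _ _ (fun y => \sum_j invmx (g_mx g a y) i j * ric (g_mx g a) y j i)) => //.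
  by move=> y _; rewrite mxE.
apply: csmooth_sum => // j; apply: csmoothM => //.
  by apply: csmooth_invmx => // x; exact: g_mx_unit.
apply: (@csmooth_eq _ _ _ (fun y => - dz j (dzbar i (logdet (g_mx g a))) y)) => //.
  by move=> y _; rewrite [RHS]mxE.
by apply: csmoothN => //; apply: csmooth_dz => //; apply: csmooth_dzbar.
Qed.

Lemma csmooth_scalar_curvature a : csmooth_on (cimg a) (scalar_curvature g a).
Proof.
apply: (csmoothM (open_cimg (a := a)) (csmooth_cst _ 2)); exact: csmooth_scal.
Qed.

Lemma csmooth_gradC u a k : csmooth_on (cimg a) (u a) ->
  csmooth_on (cimg a) (fun y => gradC g u a y 0 k).
Proof.
have oU := open_cimg (a := a); move=> su.
apply: (@csmooth_eq _ _ _ (fun y => \sum_j dzbar j (u a) y * invmx (g_mx g a y) j k)) => //.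
  by move=> y _; rewrite mxE; apply: eq_bigr => j _; rewrite mxE.
apply: csmooth_sum => // j; apply: csmoothM => //; first exact: csmooth_dzbar.
apply: csmooth_invmx => // [x|i' j']; first exact: g_mx_unit.
exact: csmooth_g_mx.
Qed.

End HermitianMetric.

Section Isometry.
Variables (g g' : metric A) (f : X -> X).
Hypotheses (g_herm : Defs.hermitian g) (g'_herm : Defs.hermitian g').
Hypotheses (f_hol : holomorphic_map A f) (f_iso : pullback2 f g' g).
Variables (a b : I).
Local Notation psi := (loc f a b).
Local Notation U := (loc_dom f a b).

Let oU : open U. Proof. exact: open_loc_dom f_hol.1. Qed.
Let oU' : open (cimg b). Proof. exact: open_cimg. Qed.
Let UU' x : U x -> cimg b (psi x). Proof. exact: loc_cimg. Qed.

Lemma csmooth_loc k : csmooth_on U (fun y => zc k (psi y)).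
Proof. exact: (f_hol.2 a b k).1. Qed.

Lemma hol_loc i k x : U x -> dzbar i (fun y => zc k (psi y)) x = 0.
Proof. exact: (f_hol.2 a b k).2. Qed.

Lemma g_mx_pullback x : U x ->
  g_mx g a x = (jac psi x)^T *m g_mx g' b (psi x) *m bar_mx (jac psi x).
Proof.
move=> Ux; have xa := loc_dom_sub Ux; have xb := UU' Ux.
apply: (@herm_mx_pullback _ _ (g a x) (g' b (psi x)) (fun v => 'D_v psi x)).
- exact: metric_lin.
- exact: metric_sym.
- exact: metric_J.
- exact: metric_lin.
- exact: metric_sym.
- exact: metric_J.
- move=> v k; rewrite (zc_derive oU csmooth_loc)//.
  rewrite (cD_expand _ oU Ux (csmooth_loc k)); apply: eq_bigr => i _.
  by rewrite hol_loc// mulr0 addr0 mxE.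
- by move=> v w; apply: f_iso.
Qed.

Let Gdet x : U x -> 0 < \det (g_mx g a x).
Proof. by move=> [xa _]; exact: g_mx_det. Qed.
Let sG' i j : csmooth_on (cimg b) (fun y => g_mx g' b y i j).
Proof. exact: csmooth_g_mx. Qed.
Let Gdet' x : cimg b x -> 0 < \det (g_mx g' b x).
Proof. exact: g_mx_det. Qed.

Lemma scal_isometry x : U x -> scal (g_mx g a) x = scal (g_mx g' b) (psi x).
Proof.
exact: (scal_pullback oU oU' UU' csmooth_loc hol_loc Gdet sG' Gdet' g_mx_pullback).
Qed.

Lemma grad_scalar_isometry x : U x ->
  gradC g (scalar_curvature g) a x *m (jac psi x)^T =
  gradC g' (scalar_curvature g') b (psi x).
Proof.
move=> Ux.
apply: (grad_pullback oU oU' UU' csmooth_loc hol_loc Gdet Gdet' g_mx_pullback _ _ Ux).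
  by move=> y Uy; rewrite !scalar_curvatureE (scal_isometry Uy).
exact: csmooth_scalar_curvature.
Qed.

Lemma inner_isometry x (v w : 'rV[C]_n) : U x ->
  inner (g_mx g a x) v w =
  inner (g_mx g' b (psi x)) (v *m (jac psi x)^T) (w *m (jac psi x)^T).
Proof. by move=> Ux; apply: inner_pullback; apply: g_mx_pullback. Qed.

End Isometry.

(** * Extremal solitons on a compact manifold *)

Section SolitonExtremal.
Variables (g : metric A) (V : vfield A).
Hypothesis g_kahler : kahler g.
Hypothesis V_hol : holomorphic_vfield V.
Hypothesis soliton_eq : forall a x v w, cimg a x ->
  ricci_form g a x v w - kahler_form g a x v w = lie V (kahler_form g) a x v w.
Local Notation T := (gradC g (scalar_curvature g)).
Hypothesis T_hol : forall a i k x, cimg a x -> dzbar i (fun y => T a y 0 k) x = 0.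

Let g_herm : Defs.hermitian g := g_kahler.1.
Local Notation G a := (g_mx g a).
Local Notation c0 := (iC R / (2 * pi)%:C).

Let oU a : open (cimg a). Proof. exact: open_cimg. Qed.
Let sG a i j : csmooth_on (cimg a) (fun y => G a y i j).
Proof. exact: csmooth_g_mx. Qed.
Let GH a x i j : cimg a x -> (G a x j i)^* = G a x i j.
Proof. exact: g_mx_herm. Qed.
Let Gdet a x : cimg a x -> 0 < \det (G a x).
Proof. exact: g_mx_det. Qed.
Let sV a k : csmooth_on (cimg a) (fun y => V a y 0 k).
Proof. exact: (V_hol.1 a k).1. Qed.
Let V_dzbar a i k x : cimg a x -> dzbar i (fun y => V a y 0 k) x = 0.
Proof. exact: (V_hol.1 a k).2. Qed.
Let sT a k : csmooth_on (cimg a) (fun y => T a y 0 k).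
Proof. by apply: csmooth_gradC => //; exact: csmooth_scalar_curvature. Qed.

Lemma c0_neq0 : c0 != 0.
Proof.
have i0 : iC R != 0.
  by apply/eqP => i0; have := iC2 R; rewrite i0 mul0r => /eqP; rewrite eq_sym oppr_eq0 oner_eq0.
rewrite mulf_neq0// invr_eq0; apply/eqP => /(congr1 (@complex.Re R)) /= /eqP.
by rewrite mulf_eq0 pnatr_eq0 /= gt_eqF// pi_gt0.
Qed.

Let GK a x i j k : cimg a x ->
  dz k (fun y => G a y i j) x = dz i (fun y => G a y k j) x.
Proof.
move=> xa.
have H := @closed_form_kahler _ _ _ (@oU a) (G a) (sG a) (kahler_form g a) _ c0_neq0.
have tE y v w : cimg a y -> kahler_form g a y v w =
    c0 * \sum_k \sum_l G a y k l * wedge11 k l v w by exact: kahler_formE.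
have {}H := H tE.
have cl y u v w (ya : cimg a y) := g_kahler.2 a y u v w ya.
have {}H := H cl.
exact: H.
Qed.

(** Both sides of the soliton equation are of type (1,1), so it is an equation
    between their coefficient matrices. *)
Lemma soliton_mx a i j x : cimg a x ->
  ric (G a) x i j = G a x i j + dz i (flat (G a) (V a) j) x.
Proof.
move=> xa; apply/eqP; rewrite -subr_eq0; apply/eqP; move: i j.
pose M i j := ric (G a) x i j - (G a x i j + dz i (flat (G a) (V a) j) x).
apply: (wedge11_inj (N := M)) => v w.
have := soliton_eq v w xa; rewrite kahler_formE//.
have -> : lie V (kahler_form g) a x v w =
    c0 * \sum_i \sum_l dz i (flat (G a) (V a) l) x * wedge11 i l v w.
  apply: (lie_form (@oU a) (sG a) (t := kahler_form g a)) => //.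
  - by move=> y v' w' ya; apply: kahler_formE.
  - by move=> y i j k ya; apply: GK.
  - by move=> i k y ya; apply: V_dzbar.
have -> : ricci_form g a x v w =
  c0 * \sum_k \sum_l ric (G a) x k l * wedge11 k l v w by [].
rewrite -mulrBr => /(mulfI c0_neq0)/eqP; rewrite -subr_eq0 => /eqP E0.
apply: etrans E0; rewrite -!sumrB; apply: eq_bigr => i _.
rewrite -!sumrB; apply: eq_bigr => l _.
by rewrite /M opprD addrA !mulrBl.
Qed.

(** The gradient of the squared norm of V ([grad_sqnorm_flat]), written so that
    it is visibly holomorphic; the gradient of scal is half of T. *)
Definition grad_sqnorm a x : 'rV[C]_n := - V a x - 2^-1 *: T a x.
Local Notation W := grad_sqnorm.

Lemma grad_sqnormE a x k : W a x 0 k = - V a x 0 k + - (2^-1 * T a x 0 k).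
Proof. by rewrite /W !mxE. Qed.

Lemma csmooth_grad_sqnorm a k : csmooth_on (cimg a) (fun y => W a y 0 k).
Proof.
apply: (@csmooth_eq _ _ _ (fun y => - V a y 0 k + - (2^-1 * T a y 0 k))) => //.
  by move=> y _; rewrite grad_sqnormE.
apply: csmoothD => //; apply: csmoothN => //; apply: csmoothM => //.
exact: csmooth_cst.
Qed.

Lemma grad_sqnorm_dzbar a i k x : cimg a x -> dzbar i (fun y => W a y 0 k) x = 0.
Proof.
move=> xa; have sT2 : csmooth_on (cimg a) (fun y => 2^-1 * T a y 0 k).
  by apply: csmoothM => //; exact: csmooth_cst.
rewrite (@dzbar_eq _ _ (cimg a) _ (fun y => - V a y 0 k + - (2^-1 * T a y 0 k)) _ _ (@oU a) xa); last first.
  by move=> y _; rewrite grad_sqnormE.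
rewrite (dzbarD xa _ (csmoothN (@oU a) (sV a k)) (csmoothN (@oU a) sT2)).
rewrite (dzbarN xa _ (sV a k)) (dzbarN xa _ sT2) (dzbarZ xa _ _ (sT a k)).
by rewrite V_dzbar// T_hol// mulr0 oppr0 addr0.
Qed.

Lemma grad_sqnorm_flat a l x : cimg a x ->
  \sum_k W a x 0 k * G a x k l = dzbar l (sqnorm (G a) (V a)) x.
Proof.
move=> xa.
have TE : \sum_k T a x 0 k * G a x k l = 2 * dzbar l (scal (G a)) x.
  rewrite gradC_flat//; apply: etrans (dzbarZ xa 2 l (csmooth_scal g_herm a)).
  by apply: dzbar_eq (@oU a) xa _ => y _; rewrite scalar_curvatureE.
have S := soliton_potential (@oU a) (sG a) (@GH a) (@Gdet a) (@GK a) (sV a)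
   (@V_dzbar a) (fun i j y ya => soliton_mx i j ya) l xa.
rewrite (eq_bigr (fun k => - (V a x 0 k * G a x k l) - 2^-1 * (T a x 0 k * G a x k l))).
  rewrite sumrB sumrN -mulr_sumr TE mulKf ?pnatr_eq0// -/(flat (G a) (V a) l x) -S.
  by rewrite addrAC subrr add0r.
by move=> k _; rewrite grad_sqnormE mulrDl !mulNr mulrA.
Qed.

Hypotheses (cX : compact [set: X]) (X0 : [set: X] !=set0).

Let jacid a b x := jac (loc (A := A) idfun a b) x.

Let V_inv a b x : loc_dom idfun a b x -> V b (loc idfun a b x) = V a x *m (jacid a b x)^T.
Proof.
move=> D; apply/rowP => k; rewrite (V_hol.2 a b x k D) [RHS]mxE.
by apply: eq_bigr => j _; rewrite mxE [jacid _ _ _ _ _]mxE.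
Qed.

Let T_inv a b x : loc_dom idfun a b x -> T b (loc idfun a b x) = T a x *m (jacid a b x)^T.
Proof.
move=> D.
by rewrite (grad_scalar_isometry g_herm g_herm (holomorphic_map_id) (metric_id g_herm) D).
Qed.

Let W_inv a b x : loc_dom idfun a b x -> W b (loc idfun a b x) = W a x *m (jacid a b x)^T.
Proof. by move=> D; rewrite /W V_inv// T_inv// mulmxBl mulNmx -scalemxAl. Qed.

Let inner_inv a b x (v w : 'rV[C]_n) : loc_dom idfun a b x ->
  inner (G a x) v w =
  inner (G b (loc idfun a b x)) (v *m (jacid a b x)^T) (w *m (jacid a b x)^T).
Proof.
exact: (inner_isometry g_herm g_herm holomorphic_map_id (metric_id g_herm)).
Qed.

Let Nrm a x := sqnorm (G a) (V a) x.
Let P a x := pairing (G a) (V a) (W a) x.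

Let smooth_Nrm a : csmooth_on (cimg a) (Nrm a).
Proof. exact: csmooth_sqnorm. Qed.

Let smooth_P a : csmooth_on (cimg a) (P a).
Proof. by apply: csmooth_pairing => //; exact: csmooth_grad_sqnorm. Qed.

Let NrmE a x : cimg a x -> Nrm a x = inner (G a x) (V a x) (V a x).
Proof.
move=> xa; rewrite /Nrm /sqnorm /inner; apply: eq_bigr => k _.
rewrite /flat rmorph_sum mulr_sumr; apply: eq_bigr => l _.
by rewrite rmorphM /= GH// -mulrA [_ * G a x k l]mulrC.
Qed.

Let PE a x : P a x = inner (G a x) (V a x) (W a x).
Proof.
rewrite /P /pairing /inner exchange_big; apply: eq_bigr => l _.
by rewrite /flat mulr_suml.
Qed.

Let Nrm_inv a b x : loc_dom idfun a b x -> Nrm a x = Nrm b (loc idfun a b x).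
Proof.
move=> D; rewrite (NrmE (loc_dom_sub D)) (NrmE (loc_cimg D)) (V_inv D).
exact: inner_inv.
Qed.

Let P_inv a b x : loc_dom idfun a b x -> P a x = P b (loc idfun a b x).
Proof. by move=> D; rewrite !PE (V_inv D) (W_inv D); exact: inner_inv. Qed.

Let smooth_cont a (u : E -> R) x : smooth_on (cimg a) u -> cimg a x ->
  {for x, continuous u}.
Proof. by move=> su xa; apply: Ck_on_continuous (su 0%N) xa. Qed.

Let P_real a x : cimg a x -> P a x = (complex.Re (P a x))%:C.
Proof.
move=> xa; have := pairing_real (@oU a) (sG a) (@GH a) (@Gdet a) (sV a)
  (@V_dzbar a) (fun i j y ya => soliton_mx i j ya) (fun l y ya => grad_sqnorm_flat l ya) xa.
rewrite -/(P a x); case: (P a x) => r s [] /eqP.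
by rewrite eq_sym -addr_eq0 -mulr2n mulrn_eq0 /= => /eqP ->.
Qed.

Let V_dP a x : cimg a x ->
  \sum_i V a x 0 i * dz i (P a) x = inner (G a x) (W a x) (W a x).
Proof.
move=> xa; exact: (soliton_derive_pairing (@oU a) (sG a) (@GH a) (@Gdet a) (sV a)
  (@V_dzbar a) (fun i j y ya => soliton_mx i j ya) (csmooth_grad_sqnorm a) (@grad_sqnorm_dzbar a)
  (fun l y ya => grad_sqnorm_flat l ya) xa).
Qed.

(** At a critical point of the pairing its derivative along V, which is |W|^2,
    vanishes. *)
Let W_crit a x : cimg a x -> (forall i, dz i (P a) x = 0) -> W a x = 0.
Proof.
move=> xa dP; apply/eqP/negPn/negP => /(g_mx_posdef g_herm xa).
by rewrite -V_dP// big1 ?ltxx// => i _; rewrite dP mulr0.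
Qed.

Let P0_at a x : W a x = 0 -> P a x = 0.
Proof.
by move=> W0; rewrite PE W0 inner0r.
Qed.

Let P_le0 a x : cimg a x -> complex.Re (P a x) <= 0.
Proof.
have [||b [y [yb ymax]]] := @global_max (fun a x => complex.Re (P a x)) _ _ cX X0.
- by move=> a' b' x' D; rewrite (P_inv D).
- by move=> a' x' xa'; apply: smooth_cont xa'; exact: (smooth_P a').1.
move=> xa; apply: le_trans (ymax _ _ xa) _.
rewrite (P0_at (W_crit yb _))// => i.
rewrite (@dz_eq _ _ (cimg b) _ (fun y => (complex.Re (P b y))%:C) _ _ (@oU b) yb).
  exact: (dz_dzbar_at_max i (@oU b) yb (smooth_P b).1 (fun z zb => ymax b z zb)).1.
by move=> z zb; exact: P_real.
Qed.

(** The minimum of P is treated as the maximum of - P. *)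
Let P_ge0 a x : cimg a x -> 0 <= complex.Re (P a x).
Proof.
have [||b [y [yb ymax]]] := @global_max (fun a x => - complex.Re (P a x)) _ _ cX X0.
- by move=> a' b' x' D; rewrite (P_inv D).
- move=> a' x' xa'; apply: smooth_cont xa'; apply: smoothN => //; exact: (smooth_P a').1.
move=> xa; rewrite -oppr_le0; apply: le_trans (ymax _ _ xa) _.
rewrite (P0_at (W_crit yb _)) ?oppr0// => i.
have [sr _] := smooth_P b.
have := (dz_dzbar_at_max i (@oU b) yb (smoothN (@oU b) sr) (fun z zb => ymax b z zb)).1.
rewrite (@dz_eq _ _ (cimg b) _ (fun y => - P b y) _ _ (@oU b) yb).
  by rewrite (dzN yb _ (smooth_P b)) => /eqP; rewrite oppr_eq0 => /eqP.
by move=> z zb; rewrite [in RHS]P_real// rmorphN.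
Qed.

(** The extreme values of the pairing are 0, so it is identically 0, and every
    point is critical. *)
Lemma grad_sqnorm_eq0 a x : cimg a x -> W a x = 0.
Proof.
move=> xa; apply: W_crit => // i; apply: etrans (dz_cst 0 i x).
apply: dz_eq (@oU a) xa _ => y ya; rewrite P_real//.
by have /le_anti -> : complex.Re (P a y) <= 0 <= complex.Re (P a y) by rewrite P_le0 ?P_ge0.
Qed.

Let dzbar_Nrm a l x : cimg a x -> dzbar l (Nrm a) x = 0.
Proof.
move=> xa; rewrite -(grad_sqnorm_flat l xa) big1// => k _.
by rewrite (grad_sqnorm_eq0 xa) mxE mul0r.
Qed.

Let dzbar_scal_flat a l x : cimg a x ->
  dzbar l (scal (G a)) x = - flat (G a) (V a) l x.
Proof.
move=> xa; have := soliton_potential (@oU a) (sG a) (@GH a) (@Gdet a) (@GK a) (sV a)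
   (@V_dzbar a) (fun i j y ya => soliton_mx i j ya) l xa.
by rewrite (dzbar_Nrm l xa) addr0.
Qed.

Let V_eq0 a x : cimg a x -> (forall l, flat (G a) (V a) l x = 0) -> V a x = 0.
Proof.
move=> xa fl0; apply: (row_free_inj (A := G a x)).
  by rewrite row_free_unit g_mx_unit.
rewrite mul0mx; apply/rowP => l; rewrite mxE [RHS]mxE; exact: fl0.
Qed.

Let NrmR a x : cimg a x -> Nrm a x = (complex.Re (Nrm a x))%:C.
Proof.
move=> xa; rewrite NrmE//; have [->|V0] := eqVneq (V a x) 0.
  by rewrite inner0l.
by have [] := gt0_complex (g_mx_posdef g_herm xa V0).
Qed.

Let scalR a x : cimg a x -> scal (G a) x = (complex.Re (scal (G a) x))%:C.
Proof.
move=> xa; have := scal_real (@oU a) (sG a) (@GH a) (@Gdet a) xa.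
case: (scal _ _) => r s [] /eqP.
by rewrite eq_sym -addr_eq0 -mulr2n mulrn_eq0 /= => /eqP ->.
Qed.

(** For every K a potential of V, because the squared norm is locally
    constant. *)
Let Q (K : R) a x : R := K * complex.Re (Nrm a x) - complex.Re (scal (G a) x).

Let sQ K a : smooth_on (cimg a) (Q K a).
Proof.
apply: smoothD => //; last by apply: smoothN => //; exact: (csmooth_scal g_herm a).1.
by apply: smoothM => //; [exact: smooth_cst | exact: (smooth_Nrm a).1].
Qed.

Let Q_crit K a x : cimg a x -> (forall y, cimg a y -> Q K a y <= Q K a x) -> V a x = 0.
Proof.
move=> xa xmax; apply: V_eq0 => // l.
have sS := csmooth_scal g_herm a.
have sK : csmooth_on (cimg a) (fun y => K%:C * Nrm a y).
  by apply: csmoothM => //; exact: csmooth_cst.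
have := (dz_dzbar_at_max l (@oU a) xa (sQ K a) xmax).2.
rewrite (@dzbar_eq _ _ (cimg a) _ (fun y => K%:C * Nrm a y + - scal (G a) y) _ _ (@oU a) xa).
  rewrite (dzbarD xa _ sK (csmoothN (@oU a) sS)) (dzbarZ xa _ _ (smooth_Nrm a)) dzbar_Nrm//.
  by rewrite mulr0 add0r (dzbarN xa _ sS) dzbar_scal_flat// opprK.
move=> y ya; rewrite /Q rmorphB rmorphM /= -NrmR// -scalR//.
Qed.

(** The maximum of Q K is attained where V, hence the norm, vanishes; so it is
    at most the maximum of Q 0, whatever K is. *)
Lemma soliton_field_eq0 a x : cimg a x -> V a x = 0.
Proof.
have Qmax K : exists b y, cimg b y /\ forall c z, cimg c z -> Q K c z <= Q K b y.
  apply: (@global_max (Q K) _ _ cX X0) => [a' b' x' D|a' x' xa'].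
    rewrite /Q (Nrm_inv D).
    by rewrite (scal_isometry g_herm g_herm holomorphic_map_id (metric_id g_herm) D).
  by apply: smooth_cont xa'; exact: sQ.
have N0 b y : V b y = 0 -> cimg b y -> Nrm b y = 0.
  by move=> V0 yb; rewrite NrmE// V0 inner0l.
move=> xa; apply/eqP/negPn/negP => V0.
have N0' : 0 < complex.Re (Nrm a x).
  by rewrite NrmE//; have [] := gt0_complex (g_mx_posdef g_herm xa V0).
have [b [y [yb ymax]]] := Qmax 0.
(* With this K the value Q K a x exceeds the maximum of Q 0 by 1. *)
pose K := (Q 0 b y + complex.Re (scal (G a) x) + 1) / complex.Re (Nrm a x).
have [c [z [zc zmax]]] := Qmax K.
have Vz := Q_crit zc (fun z' => zmax c z').
have : Q K a x <= Q 0 b y.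
  apply: le_trans (zmax _ _ xa) _; apply: le_trans (ymax _ _ zc).
  by rewrite /Q (N0 _ _ Vz zc) !mulr0.
by rewrite {1}/Q divfK ?gt_eqF// addrAC addrK gerDl leNgt ltr01.
Qed.

Lemma soliton_kahler_einstein : kahler_einstein g.
Proof.
split=> // a x v w xa; apply/eqP; rewrite -subr_eq0; apply/eqP.
rewrite soliton_eq// /lie big1// => k _.
have V0 u : cD u (fun y => V a y 0 k) x = 0.
  apply: etrans (cD_cst 0 u x); apply: cD_eq (@oU a) xa _ => y ya.
  by rewrite soliton_field_eq0// mxE.
by rewrite soliton_field_eq0// mxE !V0 !mul0r !addr0.
Qed.

End SolitonExtremal.

End Charts.

(** * The theorem *)

Section Transport.
Context (R : realType) (n : nat) (X : topologicalType) (A : complex_atlas R n X).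
Local Notation E := (cspace R n).
Local Notation C := R[i].
Variables (g g' : metric A) (phi phi' : X -> X).
Hypotheses (g_ext : extremal g) (g'_herm : Defs.hermitian g').
Hypotheses (phi_hol : holomorphic_map A phi) (phi'_hol : holomorphic_map A phi').
Hypotheses (phi'K : cancel phi' phi) (phi_iso : pullback2 phi g' g).

(** The gradient of the scalar curvature of g' is the image under phi of the
    one of g, that is a holomorphic function composed with the inverse of
    phi. *)
Lemma extremal_transport b i k y : cimg b y ->
  dzbar i (fun z => gradC g' (scalar_curvature g') b z 0 k) y = 0.
Proof.
move=> yb; have g_herm : Defs.hermitian g := g_ext.1.1.
have [a Pa] := cdom_cover A (phi' (chart_inv b y)).
set W := loc_dom phi a b; set D := loc_dom phi' b a.
have oW : open W := open_loc_dom phi_hol.1 (a := a) (b := b).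
have oD : open D := open_loc_dom phi'_hol.1 (a := b) (b := a).
have Dy : D y by [].
have DW z : D z -> W (loc phi' b a z) /\ loc phi a b (loc phi' b a z) = z.
  move=> [zb za]; have [zd zE] := cimg_inv zb.
  rewrite /W /loc_dom /loc /= chartK// phi'K zE; split=> //.
  by split=> //; exists (phi' (chart_inv b z)).
pose T := gradC g (scalar_curvature g) a.
pose psi := loc phi a b.
have sT j : csmooth_on W (fun x => T x 0 j).
  by apply: (@csmooth_sub _ _ _ (cimg a)) (g_ext.2.1 a j).1 => x [].
have T_hol l j x : W x -> dzbar l (fun x => T x 0 j) x = 0.
  by move=> [xa _]; exact: (g_ext.2.1 a j).2.
have sJ := csmooth_jac oW (@csmooth_loc _ _ _ _ _ phi_hol a b).
have J_hol := hol_jac oW (@csmooth_loc _ _ _ _ _ phi_hol a b) (@hol_loc _ _ _ _ _ phi_hol a b).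
pose h x := \sum_j T x 0 j * jac psi x k j.
have sTJ j : csmooth_on W (fun x => T x 0 j * jac psi x k j) by apply: csmoothM.
have sh : csmooth_on W h by apply: csmooth_sum.
have h_hol l x : W x -> dzbar l h x = 0.
  move=> Wx; rewrite /h (dzbar_sum oW Wx _ _ sTJ) big1// => j _.
  by rewrite (dzbarM Wx _ (sT j) (sJ k j)) T_hol// J_hol// mul0r mulr0 addr0.
rewrite (@dzbar_eq _ _ D _ (fun z => h (loc phi' b a z)) _ _ oD Dy); last first.
  move=> z Dz; have [Wz {1}<-] := DW z Dz.
  rewrite -(grad_scalar_isometry g_herm g'_herm phi_hol phi_iso Wz) mxE.
  by apply: eq_bigr => j _; congr (_ * _); rewrite [LHS]mxE.
rewrite (dzbar_pullback oD oW (fun z Dz => (DW z Dz).1) (@csmooth_loc _ _ _ _ _ phi'_hol b a)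
  (@hol_loc _ _ _ _ _ phi'_hol b a) _ Dy sh).
by rewrite big1// => l _; rewrite h_hol ?mulr0//; exact: (DW y Dy).1.
Qed.

End Transport.

Theorem corollary1p2 (R : realType) (n : nat) (X : topologicalType)
  (A : complex_atlas R n X) :
  fano_manifold A ->
  ~ (exists g0 : metric A, kahler_einstein g0) ->
  ~ (exists (g g' : metric A) (phi : X -> X),
       [/\ extremal g, kahler_ricci_soliton g', biholomorphism A phi &
           pullback2 phi g' g]).
Proof.
move=> [_ cX _ X0 _] noKE [g [g' [phi [g_ext [g'_kahler [V [V_hol V_eq]]] phi_bihol phi_iso]]]].
have [phi_hol [phi' [phi'_hol _ phi'K]]] := phi_bihol.
apply: noKE; exists g'.
apply: (soliton_kahler_einstein g'_kahler V_hol V_eq _ cX X0) => a i k x xa.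
exact: (extremal_transport g_ext g'_kahler.1 phi_hol phi'_hol phi'K phi_iso).
Qed.
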